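(* Let $0<\epsilon\ll 1$. Assume $g(t,\vec x_0,\vec w)\in L^{\infty}([0,\infty)\times\Gamma^-)$ and $h(\vec x,\vec w)\in L^{\infty}(\Omega\times\mathcal S^1)$ satisfy the compatibility condition $h(\vec x_0,\vec w)=g(0,\vec x_0,\vec w)$ for $\vec x_0\in\partial\Omega$, $\vec w\cdot\vec n<0$. Then for the unsteady neutron transport equation $$\begin{cases}\epsilon^2\partial_t u^{\epsilon}+\epsilon\,\vec w\cdot\nabla_x u^{\epsilon}+u^{\epsilon}-\bar u^{\epsilon}=0 & \text{in } [0,\infty)\times\Omega,\\ u^{\epsilon}(0,\vec x,\vec w)=h(\vec x,\vec w) & \text{in } \Omega,\\ u^{\epsilon}(t,\vec x_0,\vec w)=g(t,\vec x_0,\vec w) & \text{for } \vec w\cdot\vec n<0,\ \vec x_0\in\partial\Omega,\end{cases}$$ there exists a unique solution $u^{\epsilon}(t,\vec x,\vec w)\in L^{\infty}([0,\infty)\times\Omega\times\mathcal S^1)$, and it satisfies $$\|u^{\epsilon}\|_{L^{\infty}([0,\infty)\times\Omega\times\mathcal S^1)}\le C(\Omega)\Big(\|h\|_{L^{\infty}(\Omega\times\mathcal S^1)}+\|g\|_{L^{\infty}([0,\infty)\times\Gamma^-)}\Big).$$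
   Context: $\Omega=\{\vec x=(x_1,x_2):|\vec x|\le 1\}$ is the unit plate (disk) in $\mathbb R^2$, $\vec w=(w_1,w_2)\in\mathcal S^1$ (the unit circle) is the velocity, and $\vec n$ is the outward normal vector on $\partial\Omega$. $\Gamma^-=\{(\vec x,\vec w):\vec x\in\partial\Omega,\ \vec w\cdot\vec n<0\}$ is the in-flow boundary. The velocity average is $\bar u^{\epsilon}(t,\vec x)=\frac1{2\pi}\int_{\mathcal S^1}u^{\epsilon}(t,\vec x,\vec w)\,d\vec w$. The parameter $\epsilon$ (Knudsen number) satisfies $0<\epsilon\ll1$. $C(\Omega)>0$ denotes a constant depending only on $\Omega$ (not on $\epsilon$ or on the data). *)

(* Defs.v *)
From HB Require Import structures.
From mathcomp Require Import all_boot all_order all_algebra.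
From mathcomp Require Import all_classical all_reals all_analysis.
From mathcomp Require Import measurable_realfun.

Set Implicit Arguments.
Unset Strict Implicit.
Unset Printing Implicit Defensive.

Import Order.TTheory GRing.Theory Num.Theory.
Import numFieldNormedType.Exports.

Local Open Scope classical_set_scope.
Local Open Scope ring_scope.

Section plane.
Context {R : realType}.
Implicit Types x y : (R * R)%type.

Definition dotp x y : R := x.1 * y.1 + x.2 * y.2.

(* The library norm on R * R is the sup norm. *)
Definition enorm x : R := Num.sqrt (dotp x x).

Definition disk : set (R * R) := [set x | enorm x <= 1].

(* Serves both as the boundary of the disk and as the set of velocities. *)
Definition unit_circle : set (R * R) := [set x | enorm x = 1].

Definition outward_normal x : R * R := x.

Definition in_flow : set ((R * R) * (R * R)) :=
  [set p | [/\ unit_circle p.1, unit_circle p.2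
             & dotp p.2 (outward_normal p.1) < 0]].

Definition circle_param (a : R) : R * R := (cos a, sin a).

End plane.

(* The library's sigma-finite instance on m1 \x m2 is only inferred for
   subprobabilities. *)
Lemma sigma_finite_product d1 d2 (T1 : measurableType d1)
    (T2 : measurableType d2) (R : realType)
    (m1 : {sigma_finite_measure set T1 -> \bar R})
    (m2 : {sigma_finite_measure set T2 -> \bar R}) :
  sigma_finite [set: T1 * T2] (m1 \x m2)%E.
Proof.
have /sigma_finiteP[F [TF ndF Foo]] := sigma_finiteT m1.
have /sigma_finiteP[G [TG ndG Goo]] := sigma_finiteT m2.
exists (fun n => F n `*` G n).
  rewrite -setXTT TF TG predeqE => -[x y]; split.
    move=> [/= [n _ Fnx] [k _ Gky]]; exists (maxn n k) => //; split.
    - by move: x Fnx; exact/subsetPset/ndF/leq_maxl.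
    - by move: y Gky; exact/subsetPset/ndG/leq_maxr.
  by move=> [n _ []/= ? ?]; split; exists n.
move=> k; have [? ?] := Foo k; have [? ?] := Goo k.
split; first exact: measurableX.
by rewrite product_measure1E// lte_mul_pinfty// ge0_fin_numE.
Qed.

Section measures.
Context {R : realType}.

(* lebesgue_measure lives on the copy measurableTypeR R of R. *)
Local Notation mR := (measurableTypeR R).
Local Notation mR2 := (mR * mR)%type.

Lemma measurable_circle_param :
  measurable_fun [set: mR] (@circle_param R : mR -> mR2).
Proof.
by apply: measurable_fun_pair; apply: continuous_measurable_fun;
  [exact: continuous_cos|exact: continuous_sin].
Qed.

(* Arc length on the unit circle, as a measure on the plane. *)
Definition arc_measure : set mR2 -> \bar R :=
  pushforward (mrestr (@lebesgue_measure R) (measurable_itv `[0, 2 * pi[))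
    (@circle_param R : mR -> mR2).

Let arc_measure0 : arc_measure set0 = 0%E.
Proof. by rewrite /arc_measure /pushforward preimage_set0 measure0. Qed.

Let arc_measure_ge0 A : (0 <= arc_measure A)%E.
Proof.
apply: (@measure_ge0 _ _ _ (pushforward _ _)).
exact: measurable_circle_param.
Qed.

Let arc_measure_sigma_additive : semi_sigma_additive arc_measure.
Proof.
apply: (@measure_semi_sigma_additive _ _ _ (pushforward _ _)).
exact: measurable_circle_param.
Qed.

HB.instance Definition _ := isMeasure.Build _ _ _ arc_measure
  arc_measure0 arc_measure_ge0 arc_measure_sigma_additive.

Let arc_measure_fin : fin_num_fun arc_measure.
Proof.
move=> A mA; rewrite ge0_fin_numE; last exact: arc_measure_ge0.
apply: (@le_lt_trans _ _ (@lebesgue_measure R `[0, 2 * pi[)); last first.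
  by rewrite lebesgue_measure_itv /=; case: ifP => _; rewrite ?EFinN -?EFinB ltry.
rewrite /arc_measure /pushforward /mrestr /=.
apply: le_measure; rewrite ?inE //.
apply: measurableI => //; rewrite -[X in measurable X]setTI.
exact: measurable_circle_param.
Qed.

HB.instance Definition _ :=
  Measure_isFinite.Build _ _ _ arc_measure arc_measure_fin.

Definition plane_measure : set mR2 -> \bar R :=
  (@lebesgue_measure R \x @lebesgue_measure R)%E.

HB.instance Definition _ := Measure.on plane_measure.
HB.instance Definition _ := Measure_isSigmaFinite.Build _ _ _ plane_measure
  (sigma_finite_product (@lebesgue_measure R) (@lebesgue_measure R)).

Definition time_plane_measure : set (mR * mR2) -> \bar R :=
  (@lebesgue_measure R \x plane_measure)%E.

HB.instance Definition _ := Measure.on time_plane_measure.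
HB.instance Definition _ := Measure_isSigmaFinite.Build _ _ _ time_plane_measure
  (sigma_finite_product (@lebesgue_measure R) plane_measure).

(* dt dx dw *)
Definition phase_measure : set (mR * mR2 * mR2) -> \bar R :=
  (time_plane_measure \x arc_measure)%E.

HB.instance Definition _ := Measure.on phase_measure.
HB.instance Definition _ := Measure_isSigmaFinite.Build _ _ _ phase_measure
  (sigma_finite_product time_plane_measure arc_measure).

(* dx dw *)
Definition initial_measure : set (mR2 * mR2) -> \bar R :=
  (plane_measure \x arc_measure)%E.

HB.instance Definition _ := Measure.on initial_measure.
HB.instance Definition _ := Measure_isSigmaFinite.Build _ _ _ initial_measure
  (sigma_finite_product plane_measure arc_measure).

Definition time_arc_measure : set (mR * mR2) -> \bar R :=
  (@lebesgue_measure R \x arc_measure)%E.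

HB.instance Definition _ := Measure.on time_arc_measure.
HB.instance Definition _ := Measure_isSigmaFinite.Build _ _ _ time_arc_measure
  (sigma_finite_product (@lebesgue_measure R) arc_measure).

(* dt ds(x) dw, with ds the arc length on the boundary *)
Definition boundary_measure : set (mR * mR2 * mR2) -> \bar R :=
  (time_arc_measure \x arc_measure)%E.

HB.instance Definition _ := Measure.on boundary_measure.
HB.instance Definition _ := Measure_isSigmaFinite.Build _ _ _ boundary_measure
  (sigma_finite_product time_arc_measure arc_measure).

End measures.

Section Linfty.
Context {d : measure_display} {T : measurableType d} {R : realType}.
Variable mu : {measure set T -> \bar R}.
Implicit Types (D : set T) (f : T -> R).

(* f \_ D is f on D and 0 elsewhere. *)
Definition Linfty_norm D f : \bar R := 'N[mu]_+oo[EFin \o (f \_ D)]%E.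

Definition Linfty D f : Prop :=
  measurable_fun D f /\ (Linfty_norm D f < +oo)%E.

End Linfty.

Definition absolutely_continuous (R : realType) (a b : R) (f : R -> R) : Prop :=
  forall e : R, 0 < e -> exists2 d : R, 0 < d &
    forall (n : nat) (I : 'I_n -> R * R),
      (forall i, [/\ a <= (I i).1, (I i).1 <= (I i).2 & (I i).2 <= b]) ->
      trivIset [set: 'I_n] (fun i => `](I i).1, (I i).2[%classic) ->
      \sum_(i < n) ((I i).2 - (I i).1) < d ->
      \sum_(i < n) `|f (I i).2 - f (I i).1| < e.

Section transport.
Context {R : realType}.
Implicit Types (z : R * (R * R) * (R * R)) (u g : R * (R * R) * (R * R) -> R).

(* Points z = (t, x, w) are written ((t, x), w). *)
Definition phase_domain : set (R * (R * R) * (R * R)) :=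
  [set z | [/\ 0 <= z.1.1, disk z.1.2 & unit_circle z.2]].

Definition initial_domain : set ((R * R) * (R * R)) := disk `*` unit_circle.

Definition boundary_domain : set (R * (R * R) * (R * R)) :=
  [set z | 0 <= z.1.1 /\ in_flow (z.1.2, z.2)].

Definition velocity_average u (t : R) (x : R * R) : R :=
  (2 * pi)^-1 * Rintegral arc_measure unit_circle (fun w => u (t, x, w)).

Definition transport_direction (eps : R) (w : R * R) : R * (R * R) * (R * R) :=
  (eps ^+ 2, eps *: w, 0).

(* eps ^+ 2 * d_t + eps * w . grad_x is the derivative along
   transport_direction eps w.  As u is merely bounded, the equation is read
   along characteristics: u is absolutely continuous on almost every
   characteristic up to its end points in the closed domain, the directional
   derivative exists and satisfies the equation almost everywhere, and the
   initial and in-flow data are the values of u at t = 0 and on the in-flow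
   boundary.  Absolute continuity is what makes these values the traces of u,
   although the sets carrying them are null for phase_measure. *)
Definition transport_solution (eps : R) (g : R * (R * R) * (R * R) -> R)
    (h : (R * R) * (R * R) -> R) (u : R * (R * R) * (R * R) -> R) : Prop :=
  [/\ Linfty phase_measure phase_domain u,
      {ae phase_measure, forall z, phase_domain z -> forall a b : R, a <= b ->
         phase_domain (z + a *: transport_direction eps z.2) ->
         phase_domain (z + b *: transport_direction eps z.2) ->
         absolutely_continuous a b
           (fun s => u (z + s *: transport_direction eps z.2))},
      {ae phase_measure, forall z, phase_domain z ->
         derivable u z (transport_direction eps z.2) /\
         'D_(transport_direction eps z.2) u z
           + u z - velocity_average u z.1.1 z.1.2 = 0},
      {ae initial_measure, forall p, initial_domain p ->
         u (0, p.1, p.2) = h p}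
    & {ae boundary_measure, forall z, boundary_domain z -> u z = g z}].

End transport.

(* Main.v *)
Require Import Defs.
From mathcomp Require Import all_boot all_order all_algebra.
From mathcomp Require Import all_classical all_reals all_analysis.
From mathcomp Require Import measurable_realfun ess_sup_inf.
From mathcomp Require Import ring lra.

Set Implicit Arguments.
Unset Strict Implicit.
Unset Printing Implicit Defensive.

Import Order.TTheory GRing.Theory Num.Theory.
Import numFieldNormedType.Exports.

Local Open Scope classical_set_scope.
Local Open Scope ring_scope.

(**
Along a characteristic s |-> (t + s eps^2, x + s eps w, w) the equation reads
f' + f = m, with m(t, x) the velocity average of the solution, and almost
every characteristic enters the domain through the initial plane or the in-flow
boundary. As the disk has diameter 2, a characteristic stays in the domain for a
parameter time at most 2 / eps. Duhamel's formula along characteristics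
([mild_solution]) therefore turns a source bounded by M and data bounded by M
into a solution bounded by M, and two solutions with the same data and sources
that differ by at most K differ by at most q K, where q = 1 - e^(-2/eps) < 1.
Averaging in velocity does not increase sup norms, so m is the fixed point of a
contraction ([exists_mild_fixed_point]); with M the sum of the norms of the data,
this gives existence together with the bound, uniformly in eps.

The same contraction gives uniqueness ([contraction]): if two solutions differ
by at most K almost everywhere, so do their averages, and their difference f on
a characteristic is absolutely continuous, vanishes at the entry point and has
|f' + f| <= K almost everywhere, so that |f| <= q K ([AC_duhamel]). An absolutely
continuous function with nonpositive derivative almost everywhere is
nonincreasing ([AC_nonincreasing]), which is what this estimate rests on.

The analytic content of both halves is the passage between null sets of the
phase space and null sets on characteristics. Translations preserve null sets, so
by Fubini a measurable set is null as soon as it meets every characteristic in a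
null set, and conversely a null set meets almost every characteristic in a null
set ([ae_of_ae_flow], [ae_flow_ae]). The data are only prescribed almost
everywhere on the boundary, so uniqueness also needs that almost every
characteristic avoids a given null set of the boundary ([ae_entry_point]): for a
fixed direction w, the position of the chord through a point of the circle is a
Lipschitz function of the angle of that point, and Lipschitz maps preserve null
sets of the line ([negligible_lipschitz_image]).
*)

(** * Null sets of product measures *)

(** Trades a property for the complement of a measurable null set, to which Fubini
applies. *)
Lemma aeP d (T : measurableType d) (R : realType)
    (m : {measure set T -> \bar R}) (P : T -> Prop) :
  {ae m, forall x, P x} ->
  exists2 N : set T, measurable N & {ae m, forall x, ~ N x} /\
    (forall x, ~ N x -> P x).
Proof.
move=> [N [mN N0 PN]]; exists N => //; split.
  by exists N; split => // x /= /contrapT.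
by move=> x Nx; apply: contrapT => Px; apply: Nx; exact: PN.
Qed.

Lemma ae_imply d (T : measurableType d) (R : realType)
    (m : {measure set T -> \bar R}) (P Q : T -> Prop) :
  (forall x, P x -> Q x) -> {ae m, forall x, P x} -> {ae m, forall x, Q x}.
Proof. by move=> PQ; apply: filterS. Qed.

Lemma ae_imply2 d (T : measurableType d) (R : realType)
    (m : {measure set T -> \bar R}) (P Q S : T -> Prop) :
  (forall x, P x -> Q x -> S x) ->
  {ae m, forall x, P x} -> {ae m, forall x, Q x} -> {ae m, forall x, S x}.
Proof. by move=> PQ; apply: filterS2. Qed.

Lemma ae_and d (T : measurableType d) (R : realType)
    (m : {measure set T -> \bar R}) (P Q : T -> Prop) :
  {ae m, forall x, P x} -> {ae m, forall x, Q x} ->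
  {ae m, forall x, P x /\ Q x}.
Proof. by apply: ae_imply2. Qed.

Lemma ae_measure0 d (T : measurableType d) (R : realType)
    (m : {measure set T -> \bar R}) (N : set T) : measurable N ->
  {ae m, forall x, ~ N x} <-> m N = 0%E.
Proof.
move=> mN; rewrite -(negligibleP m mN); split.
  by apply: negligibleS => x Nx /=; apply.
by apply: negligibleS => x /= /contrapT.
Qed.

Section ae_product.
Context d1 d2 (T1 : measurableType d1) (T2 : measurableType d2) (R : realType).
Variables (m1 : {sigma_finite_measure set T1 -> \bar R})
          (m2 : {sigma_finite_measure set T2 -> \bar R}).
Local Notation m12 := (m1 \x m2)%E.

Lemma null_xsection (N : set (T1 * T2)) : measurable N ->
  m12 N = 0%E <-> {ae m1, forall x, m2 (xsection N x) = 0%E}.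
Proof.
move=> mN; rewrite /product_measure1.
have mf : measurable_fun setT (m2 \o xsection N).
  exact: measurable_fun_xsection.
have -> : (\int[m1]_x (m2 \o xsection N) x = \int[m1]_x `|(m2 \o xsection N) x|)%E.
  by apply: eq_integral => x _ /=; rewrite gee0_abs.
rewrite ae_eq_integral_abs//; split; apply: filterS => x /=.
- by apply.
- by move=> ->.
Qed.

Lemma null_ysection (N : set (T1 * T2)) : measurable N ->
  m12 N = 0%E <-> {ae m2, forall y, m1 (ysection N y) = 0%E}.
Proof.
move=> mN.
have -> : m12 N = (\int[m2]_y (m1 \o ysection N) y)%E.
  have := @indic_fubini_tonelli _ _ _ _ _ m1 m2 N mN.
  by rewrite indic_fubini_tonelli_FE// indic_fubini_tonelli_GE.
have mf : measurable_fun setT (m1 \o ysection N).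
  exact: measurable_fun_ysection.
have -> : (\int[m2]_x (m1 \o ysection N) x = \int[m2]_x `|(m1 \o ysection N) x|)%E.
  by apply: eq_integral => x _ /=; rewrite gee0_abs.
rewrite ae_eq_integral_abs//; split; apply: filterS => x /=.
- by apply.
- by move=> ->.
Qed.

Lemma ae_prod_xP (N : set (T1 * T2)) : measurable N ->
  {ae m12, forall z, ~ N z} <->
  {ae m1, forall x, {ae m2, forall y, ~ N (x, y)}}.
Proof.
move=> mN; rewrite ae_measure0// null_xsection//.
split; apply: filterS => x; rewrite -ae_measure0 ?xsectionE//;
  by rewrite -xsectionE; exact: measurable_xsection.
Qed.

Lemma ae_prod_yP (N : set (T1 * T2)) : measurable N ->
  {ae m12, forall z, ~ N z} <->
  {ae m2, forall y, {ae m1, forall x, ~ N (x, y)}}.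
Proof.
move=> mN; rewrite ae_measure0// null_ysection//.
split; apply: filterS => x; rewrite -ae_measure0 ?ysectionE//;
  by rewrite -ysectionE; exact: measurable_ysection.
Qed.

Lemma ae_prod_x (P : T1 * T2 -> Prop) : {ae m12, forall z, P z} ->
  {ae m1, forall x, {ae m2, forall y, P (x, y)}}.
Proof.
move=> /aeP[N mN [/(ae_prod_xP mN) + NP]].
by apply: filterS => x; apply: filterS => y /NP.
Qed.

Lemma ae_prod_y (P : T1 * T2 -> Prop) : {ae m12, forall z, P z} ->
  {ae m2, forall y, {ae m1, forall x, P (x, y)}}.
Proof.
move=> /aeP[N mN [/(ae_prod_yP mN) + NP]].
by apply: filterS => x; apply: filterS => y /NP.
Qed.

Lemma ae_prod_fst (P : T1 -> Prop) : {ae m1, forall x, P x} ->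
  {ae m12, forall z, P z.1}.
Proof.
move=> /aeP[N mN [aeN NP]].
have mN' : measurable ((fst : T1 * T2 -> T1) @^-1` N).
  by rewrite -[X in measurable X]setTI; exact: measurable_fst.
suff : {ae m12, forall z, ~ (fst @^-1` N) z} by apply: filterS => z /= /NP.
by apply/ae_prod_xP => //; move: aeN; apply: filterS => x Nx; exact: aeW.
Qed.

End ae_product.

Section skew.
Context d1 d1' d2 (T1 : measurableType d1) (T1' : measurableType d1')
  (T2 : measurableType d2) (R : realType).
Variables (m1 : {sigma_finite_measure set T1 -> \bar R})
  (m1' : {sigma_finite_measure set T1' -> \bar R})
  (m2 : {sigma_finite_measure set T2 -> \bar R}).

(** A skew product of null-preserving maps preserves null sets; the hypothesis [Q]
restricts the claim to a part of the source. *)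
Lemma ae_skew_y (phi : T2 -> T1 -> T1') (Q : set (T1 * T2)) :
  measurable_fun setT (fun z : T1 * T2 => (phi z.2 z.1, z.2)) -> measurable Q ->
  {ae m2, forall y, forall P : set T1', {ae m1', forall x, P x} ->
    {ae m1, forall x, Q (x, y) -> P (phi y x)}} ->
  forall P : set (T1' * T2), {ae (m1' \x m2)%E, forall z, P z} ->
  {ae (m1 \x m2)%E, forall z, Q z -> P (phi z.2 z.1, z.2)}.
Proof.
move=> mphi mQ aephi P /aeP[N mN [/(ae_prod_yP _ _ mN) aeN NP]].
set F := fun z : T1 * T2 => _ in mphi.
suff : {ae (m1 \x m2)%E, forall z, ~ (Q `&` F @^-1` N) z}.
  by apply: filterS => z QN Qz; apply: NP => Nz; exact: QN.
have mF : measurable (Q `&` F @^-1` N).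
  apply: measurableI => //; rewrite -[X in measurable X]setTI.
  by apply: mphi.
apply/ae_prod_yP => //.
move: aephi aeN; apply: filterS2 => y aephi /aephi.
by apply: filterS => x xy [/= /xy].
Qed.

End skew.

Section skew_x.
Context d1 d2 d2' (T1 : measurableType d1) (T2 : measurableType d2)
  (T2' : measurableType d2') (R : realType).
Variables (m1 : {sigma_finite_measure set T1 -> \bar R})
  (m2 : {sigma_finite_measure set T2 -> \bar R})
  (m2' : {sigma_finite_measure set T2' -> \bar R}).

Lemma ae_skew_x (phi : T1 -> T2 -> T2') (Q : set (T1 * T2)) :
  measurable_fun setT (fun z : T1 * T2 => (z.1, phi z.1 z.2)) -> measurable Q ->
  {ae m1, forall x, forall P : set T2', {ae m2', forall y, P y} ->
    {ae m2, forall y, Q (x, y) -> P (phi x y)}} ->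
  forall P : set (T1 * T2'), {ae (m1 \x m2')%E, forall z, P z} ->
  {ae (m1 \x m2)%E, forall z, Q z -> P (z.1, phi z.1 z.2)}.
Proof.
move=> mphi mQ aephi P /aeP[N mN [/(ae_prod_xP _ _ mN) aeN NP]].
set F := fun z : T1 * T2 => _ in mphi.
suff : {ae (m1 \x m2)%E, forall z, ~ (Q `&` F @^-1` N) z}.
  by apply: filterS => z QN Qz; apply: NP => Nz; exact: QN.
have mF : measurable (Q `&` F @^-1` N).
  apply: measurableI => //; rewrite -[X in measurable X]setTI.
  by apply: mphi.
apply/ae_prod_xP => //.
move: aephi aeN; apply: filterS2 => y aephi /aephi.
by apply: filterS => x xy [/= /xy].
Qed.

End skew_x.

Section ae_prod_map.
Context d1 d1' d2 d2' (T1 : measurableType d1) (T1' : measurableType d1')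
  (T2 : measurableType d2) (T2' : measurableType d2') (R : realType).
Variables (m1 : {sigma_finite_measure set T1 -> \bar R})
  (m1' : {sigma_finite_measure set T1' -> \bar R})
  (m2 : {sigma_finite_measure set T2 -> \bar R})
  (m2' : {sigma_finite_measure set T2' -> \bar R}).

Lemma ae_prod_map (f1 : T1 -> T1') (f2 : T2 -> T2') :
  measurable_fun setT f1 -> measurable_fun setT f2 ->
  (forall P, {ae m1', forall x, P x} -> {ae m1, forall x, P (f1 x)}) ->
  (forall P, {ae m2', forall x, P x} -> {ae m2, forall x, P (f2 x)}) ->
  forall P : set (T1' * T2'), {ae (m1' \x m2')%E, forall z, P z} ->
  {ae (m1 \x m2)%E, forall z, P (f1 z.1, f2 z.2)}.
Proof.
move=> mf1 mf2 n1 n2 P /aeP[N mN [/(ae_prod_xP _ _ mN) aeN NP]].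
pose F := fun z : T1 * T2 => (f1 z.1, f2 z.2).
have mF : measurable_fun setT F.
  by apply: measurable_fun_pair; exact: measurableT_comp.
suff : {ae (m1 \x m2)%E, forall z, ~ (F @^-1` N) z}.
  by apply: filterS => z NFz; exact: NP.
apply/ae_prod_xP; first by rewrite -[X in measurable X]setTI; exact: mF.
by move/n1: aeN; apply: filterS => x /n2.
Qed.

End ae_prod_map.

(** * Lipschitz images of Lebesgue null sets *)

Section lipschitz_null.
Context {R : realType}.
Local Notation mu := (@lebesgue_measure R).

(** Cover the null set by open intervals of small total length; the image of an
interval lies in one whose length is at most 2 L times larger. *)
Lemma negligible_lipschitz_image (L : R) (f : R -> R) (N : set R) : 0 < L ->
  (forall x y, `|f x - f y| <= L * `|x - y|) ->
  mu.-negligible N -> mu.-negligible (f @` N).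
Proof.
move=> L0 Lf /negligible_outer_measure; rewrite outer_measure_open_itv_cover.
move=> N0; apply/negligible_outer_measure; apply/eqP.
rewrite eq_le outer_measure_ge0 andbT.
apply/lee_addgt0Pr => e e0; rewrite add0e.
have eL : (0 < (e / (2 * L))%:E)%E by rewrite lte_fin divr_gt0// mulr_gt0.
move: (eL); rewrite -N0 => /ereal_inf_lt[_ [F [Fitv NF] <-] Fe].
have /all_sig[ab abF] k : {ab : R * R | `]ab.1, ab.2[%classic = F k}.
  by have /cid[ab ->] := Fitv k; exists ab.
have Fl k : wlength idfun (F k) = mu (F k).
  by rewrite -abF lebesgue_measure_itv/= wlength_itv.
(* [G k] is centred at the image of the midpoint of [F k]. *)
pose c k := if (ab k).1 < (ab k).2 then f (((ab k).1 + (ab k).2) / 2) else 0.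
pose r k : R := if (ab k).1 < (ab k).2 then L * ((ab k).2 - (ab k).1) else 0.
pose G k := `[c k - r k, c k + r k]%classic.
have NG : f @` N `<=` \bigcup_k G k.
  move=> _ [x /NF[k _ Fkx] <-]; exists k => //.
  move: Fkx; rewrite -abF/= in_itv/= => /andP[ax xb].
  have ltab := lt_trans ax xb.
  rewrite /G /c /r ltab /= in_itv/= -ler_distl (le_trans (Lf _ _))//.
  rewrite ler_pM2l// ler_distl; apply/andP; split; lra.
have muG k : (mu (G k) <= (2 * L)%:E * mu (F k))%E.
  rewrite -abF !lebesgue_measure_itv/= !lte_fin.
  have -> : (c k - r k < c k + r k) = ((ab k).1 < (ab k).2).
    rewrite /r; case: ifPn => [?|_]; last by rewrite subr0 addr0 ltxx.
    by apply/idP; rewrite ltrBlDr -addrA ltrDl addr_gt0// mulr_gt0// subr_gt0.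
  rewrite /r; case: ((ab k).1 < (ab k).2); last by rewrite mule0.
  by rewrite -!EFinD -EFinM lee_fin le_eqVlt; apply/orP; left; apply/eqP; ring.
apply: (le_trans (le_outer_measure (wlength idfun)^*%mu _ _ NG)).
apply: (le_trans (outer_measure_sigma_subadditive (wlength idfun)^*%mu G)).
apply: (@le_trans _ _ (\sum_(0 <= k <oo) ((2 * L)%:E * wlength idfun (F k)))%E).
  by apply: lee_nneseries => k *; [exact: outer_measure_ge0|rewrite Fl; exact: muG].
rewrite nneseriesZl; last by move=> k _; rewrite Fl.
rewrite -lee_pdivlMl ?mulr_gt0// -EFinM mulrC; exact: ltW.
Qed.

Lemma ae_translate (a : R) (P : R -> Prop) :
  {ae mu, forall x, P x} -> {ae mu, forall x, P (x + a)}.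
Proof.
move=> /(@negligible_lipschitz_image 1 (fun x => x - a)) aeP.
have : mu.-negligible ((fun x => x - a) @` (~` [set x | P x])).
  by apply: aeP => // x y; rewrite mul1r opprB addrA subrK.
by apply: negligibleS => x /= Px; exists (x + a) => //; rewrite addrK.
Qed.

End lipschitz_null.

(** * Geometry of the characteristics *)

Section flow.
Context {R : realType}.
Implicit Types (x w : R * R) (z : R * (R * R) * (R * R)) (eps s : R).

Lemma diskE x : disk x <-> dotp x x <= 1.
Proof.
by rewrite /disk /enorm/= -[X in _ <= X]sqrtr1 ler_sqrt ?ltr01.
Qed.

Lemma dotp_ge0 x : 0 <= dotp x x.
Proof. by rewrite /dotp -!expr2 addr_ge0// sqr_ge0. Qed.

Lemma unit_circleE x : unit_circle x <-> dotp x x = 1.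
Proof.
rewrite /unit_circle /enorm/=; split => [h|->]; last by rewrite sqrtr1.
by rewrite -(sqr_sqrtr (dotp_ge0 x)) h expr1n.
Qed.

(** Coordinate form of [z + s *: transport_direction eps z.2], see [flowE]. *)
Definition flow eps s z : R * (R * R) * (R * R) :=
  (z.1.1 + s * eps ^+ 2,
   (z.1.2.1 + s * (eps * z.2.1), z.1.2.2 + s * (eps * z.2.2)), z.2).

Lemma flowE eps s z : z + s *: transport_direction eps z.2 = flow eps s z.
Proof.
case: z => -[t [x1 x2]] [w1 w2]; rewrite /flow /transport_direction/=.
by congr ((_, (_, _)), (_, _)); rewrite /= ?scaler0 ?addr0.
Qed.

Lemma flow0 eps z : flow eps 0 z = z.
Proof. by rewrite /flow !mul0r !addr0; case: z => -[? []]. Qed.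

Lemma flowD eps a b z : flow eps a (flow eps b z) = flow eps (b + a) z.
Proof. by rewrite /flow/= !mulrDl !addrA. Qed.

(** A quarter of the discriminant of |x - s w|^2 = 1 as an equation in s. *)
Definition discr x w : R := dotp x w ^+ 2 + 1 - dotp x x.

(** The larger root of |x - s w|^2 = 1: how far x lies behind the point where its
chord of direction w enters the disk. *)
Definition entry_distance x w : R := dotp x w + Num.sqrt (discr x w).

Definition entry_time eps z : R :=
  Num.min (z.1.1 / eps ^+ 2) (entry_distance z.1.2 z.2 / eps).

Definition entry_point eps z := flow eps (- entry_time eps z) z.

Lemma dotp_flow eps s z : unit_circle z.2 ->
  dotp (flow eps s z).1.2 z.2 = dotp z.1.2 z.2 + s * eps.
Proof.
case: z => -[t [x1 x2]] [w1 w2] /unit_circleE; rewrite /dotp/= => w1E.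
by rewrite -[s * eps in RHS]mulr1 -w1E; ring.
Qed.

Lemma sqnorm_flow eps s z : unit_circle z.2 ->
  dotp (flow eps s z).1.2 (flow eps s z).1.2 =
  dotp z.1.2 z.1.2 + 2 * (s * eps) * dotp z.1.2 z.2 + (s * eps) ^+ 2.
Proof.
case: z => -[t [x1 x2]] [w1 w2] /unit_circleE; rewrite /dotp/= => w1E.
have -> : (s * eps) ^+ 2 = (s * eps) ^+ 2 * (w1 * w1 + w2 * w2).
  by rewrite w1E mulr1.
ring.
Qed.

(** The chord, hence the discriminant, is the same at all points of a
characteristic; this makes the entry time additive along it. *)
Lemma discr_flow eps s z : unit_circle z.2 ->
  discr (flow eps s z).1.2 z.2 = discr z.1.2 z.2.
Proof. by move=> z2; rewrite /discr dotp_flow// sqnorm_flow//; ring. Qed.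

Lemma entry_time_flow eps s z : 0 < eps -> unit_circle z.2 ->
  entry_time eps (flow eps s z) = entry_time eps z + s.
Proof.
move=> e0 z2; rewrite /entry_time /entry_distance dotp_flow// discr_flow//=.
rewrite addr_minl; congr (Num.min _ _); field; exact: lt0r_neq0.
Qed.

Lemma entry_point_flow eps s z : 0 < eps -> unit_circle z.2 ->
  entry_point eps (flow eps s z) = entry_point eps z.
Proof.
by move=> e0 z2; rewrite /entry_point entry_time_flow// flowD opprD addrCA subrr addr0.
Qed.

Lemma flow_entry eps z : flow eps (entry_time eps z) (entry_point eps z) = z.
Proof. by rewrite /entry_point flowD addNr flow0. Qed.

End flow.

Section entry.
Context {R : realType}.
Implicit Types (x w : R * R) (z : R * (R * R) * (R * R)) (eps s : R).

Lemma discr_ge x w : disk x -> dotp x w ^+ 2 <= discr x w.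
Proof. by move=> /diskE xD; rewrite /discr -addrA lerDl subr_ge0. Qed.

Lemma discr_disk_ge0 x w : disk x -> 0 <= discr x w.
Proof. by move=> xD; apply: le_trans (discr_ge w xD); exact: sqr_ge0. Qed.

Lemma norm_dotp_le x w : disk x -> `|dotp x w| <= Num.sqrt (discr x w).
Proof. by move=> xD; rewrite -sqrtr_sqr; apply: ler_wsqrtr; exact: discr_ge. Qed.

Lemma cauchy_schwarz x w : dotp x w ^+ 2 <= dotp x x * dotp w w.
Proof.
rewrite -subr_ge0.
have -> : dotp x x * dotp w w - dotp x w ^+ 2 = (x.1 * w.2 - x.2 * w.1) ^+ 2.
  by rewrite /dotp; ring.
exact: sqr_ge0.
Qed.

Lemma entry_distance_ge0 x w : disk x -> 0 <= entry_distance x w.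
Proof.
by move=> /(norm_dotp_le w); rewrite ler_norml => /andP[+ _]; rewrite /entry_distance; lra.
Qed.

Lemma entry_distance_le2 x w : disk x -> unit_circle w ->
  entry_distance x w <= 2.
Proof.
move=> /diskE xD /unit_circleE w1; have := cauchy_schwarz x w.
rewrite w1 mulr1 => cs.
have d1 : discr x w <= 1 by rewrite /discr; lra.
have s1 : Num.sqrt (discr x w) <= 1 by rewrite -[leRHS]sqrtr1 ler_wsqrtr.
have : dotp x w <= 1.
  rewrite (le_trans (ler_norm _))// -sqrtr_sqr -[leRHS]sqrtr1 ler_wsqrtr//; lra.
by rewrite /entry_distance; lra.
Qed.

Lemma entry_time_ge0 eps z : 0 < eps -> phase_domain z -> 0 <= entry_time eps z.
Proof.
move=> e0 [t0 xD _]; rewrite /entry_time le_min !divr_ge0 ?sqr_ge0 ?(ltW e0)//=.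
exact: entry_distance_ge0.
Qed.

Lemma entry_time_le eps z : 0 < eps -> phase_domain z ->
  entry_time eps z <= 2 / eps.
Proof.
move=> e0 [t0 xD z2]; rewrite /entry_time ge_min; apply/orP; right.
by rewrite ler_pM2r ?invr_gt0// entry_distance_le2.
Qed.

(** |x - s w|^2 - 1 is a convex quadratic in s that is at most 0 at s = 0 and
vanishes at the entry distance, so it is at most 0 in between. *)
Lemma phase_domain_flow eps s z : 0 < eps -> phase_domain z ->
  0 <= s -> s <= entry_time eps z -> phase_domain (flow eps (- s) z).
Proof.
move=> e0 [t0 xD z2] s0; rewrite /entry_time le_min => /andP[st sd].
split => //.
  by rewrite /= mulNr subr_ge0 -ler_pdivlMr// exprn_gt0.
move: sd; rewrite ler_pdivlMr// => sd.
apply/diskE; rewrite sqnorm_flow//.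
have se0 : 0 <= s * eps by rewrite mulr_ge0// ltW.
move: sd se0; set r := s * eps => sd se0.
have := norm_dotp_le z.2 xD; rewrite ler_norml => /andP[lo hi].
have q : Num.sqrt (discr z.1.2 z.2) ^+ 2 = discr z.1.2 z.2.
  by rewrite sqr_sqrtr// discr_disk_ge0.
move: q sd lo hi; rewrite /entry_distance /discr mulNr -/r.
set b := dotp _ z.2; set n := dotp _ _; set q := Num.sqrt _ => qE sd lo hi.
have : 0 <= (b + q - r) * (q + r - b) by apply: mulr_ge0; lra.
have -> : (b + q - r) * (q + r - b) = q ^+ 2 - b ^+ 2 + 2 * r * b - r ^+ 2 by ring.
rewrite qE; lra.
Qed.

Lemma phase_domain_entry_point eps z : 0 < eps -> phase_domain z ->
  phase_domain (entry_point eps z).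
Proof. by move=> e0 zD; apply: phase_domain_flow => //; exact: entry_time_ge0. Qed.

Lemma entry_time_initial eps z : 0 < eps -> phase_domain z -> z.1.1 = 0 ->
  entry_time eps z = 0.
Proof.
move=> e0 zD t0; apply/eqP; rewrite eq_le entry_time_ge0// andbT.
by rewrite /entry_time t0 mul0r ge_min lexx.
Qed.

Lemma in_flow_disk x w : in_flow (x, w) -> disk x.
Proof. by move=> [/unit_circleE/= xE _ _]; apply/diskE; rewrite xE. Qed.

Lemma dotpC x y : dotp x y = dotp y x.
Proof. by rewrite /dotp mulrC [X in _ + X]mulrC. Qed.

Lemma entry_time_in_flow eps z : 0 < eps -> boundary_domain z ->
  entry_time eps z = 0.
Proof.
move=> e0 [t0 zin]; apply/eqP; rewrite eq_le entry_time_ge0// ?andbT; last first.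
  by split => //; [exact: in_flow_disk zin|case: zin].
rewrite /entry_time ge_min; apply/orP; right.
case: zin => /unit_circleE/= xE _; rewrite /outward_normal dotpC => xw.
rewrite /entry_distance /discr xE addrK sqrtr_sqr ltr0_norm// subrr mul0r//.
Qed.

(** With a positive discriminant the chord crosses the circle transversally, so that
its entry point lies on the in-flow boundary; tangents have discriminant 0. *)
Lemma entry_point_cases eps z : 0 < eps -> phase_domain z ->
  0 < discr z.1.2 z.2 ->
  [\/ (entry_point eps z).1.1 = 0 |
      0 < (entry_point eps z).1.1 /\
      entry_time eps z = entry_distance z.1.2 z.2 / eps /\
      boundary_domain (entry_point eps z)].
Proof.
move=> e0 zD d0; have [yt0 yD yw] := phase_domain_entry_point e0 zD.
have [zt0 zx zw] := zD.
have [->|yt] := eqVneq (entry_point eps z).1.1 0; first by left.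
right; split; first by rewrite lt_neqAle eq_sym yt.
have tE : entry_time eps z = entry_distance z.1.2 z.2 / eps.
  rewrite /entry_time; apply/min_idPr; rewrite leNgt; apply/negP => lt.
  move/eqP: yt; apply; rewrite /= /entry_time (min_idPl _) ?ltW//.
  by rewrite mulNr divfK ?subrr// expf_neq0// lt0r_neq0.
split => //; split => //; split => //=.
  apply/unit_circleE; rewrite /entry_point sqnorm_flow// tE mulNr divfK ?lt0r_neq0//.
  have : Num.sqrt (discr z.1.2 z.2) ^+ 2 = discr z.1.2 z.2 by rewrite sqr_sqrtr// ltW.
  rewrite /entry_distance; move: (Num.sqrt _) => q; rewrite /discr => qE.
  rewrite sqrrN sqrrD qE; ring.
rewrite /outward_normal dotpC -[X in dotp _ X]/(z.2) dotp_flow// tE mulNr.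
rewrite divfK ?lt0r_neq0// /entry_distance opprD addrA subrr add0r oppr_lt0.
by rewrite sqrtr_gt0.
Qed.

End entry.

(** * Measurability *)

Ltac measurability := repeat match goal with
  | |- measurable_fun _ (fun z => (@?f z, @?g z)) => apply: measurable_fun_pair
  | |- measurable_fun _ (fun z => @?f z + - @?g z) => apply: measurable_funB
  | |- measurable_fun _ (fun z => @?f z + @?g z) => apply: measurable_funD
  | |- measurable_fun _ (fun z => @?f z * @?g z) => apply: measurable_funM
  | |- measurable_fun _ (fun z => @?f z ^+ _) => apply: measurable_funX
  | |- measurable_fun _ (fun z => - @?f z) =>
      apply: (measurableT_comp (@oppr_measurable _ setT))
  | |- measurable_fun _ (fun _ => ?c) => exact: measurable_cst
  | |- measurable_fun _ (fun z => z) => exact: measurable_id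
  | |- measurable_fun _ (fun z => fst z) => exact: measurable_fst
  | |- measurable_fun _ (fun z => snd z) => exact: measurable_snd
  | |- measurable_fun _ fst => exact: measurable_fst
  | |- measurable_fun _ snd => exact: measurable_snd
  | |- measurable_fun _ (fun z => fst (@?f z)) =>
      apply: (measurableT_comp measurable_fst)
  | |- measurable_fun _ (fun z => snd (@?f z)) =>
      apply: (measurableT_comp measurable_snd)
  end.

Section measurability.
Context {R : realType}.
Local Notation mR := (measurableTypeR R).
Local Notation mR2 := (mR * mR)%type.
Local Notation mR3 := (mR * mR2)%type.
Local Notation mP := (mR * mR2 * mR2)%type.
Implicit Types eps s : R.

Lemma measurable_sqrt : measurable_fun [set: R] (@Num.sqrt R).
Proof. by apply: continuous_measurable_fun; exact: sqrt_continuous. Qed.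

Lemma measurable_dotp : measurable_fun [set: mR2 * mR2]
  (fun p : mR2 * mR2 => dotp p.1 p.2 : R).
Proof. rewrite /dotp; measurability. Qed.

Lemma measurable_discr : measurable_fun [set: mR2 * mR2]
  (fun p : mR2 * mR2 => discr p.1 p.2 : R).
Proof. rewrite /discr /dotp; measurability. Qed.

Lemma measurable_entry_distance : measurable_fun [set: mR2 * mR2]
  (fun p : mR2 * mR2 => entry_distance p.1 p.2 : R).
Proof.
apply: measurable_funD; first exact: measurable_dotp.
exact: (measurableT_comp measurable_sqrt measurable_discr).
Qed.

Lemma measurable_entry_time eps : measurable_fun [set: mP]
  (entry_time eps : mP -> R).
Proof.
apply: measurable_minr; first by measurability.
apply: measurable_funM; last exact: measurable_cst.
apply: (measurableT_comp measurable_entry_distance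
  (g := fun z : mP => (z.1.2, z.2))).
measurability.
Qed.

Lemma measurable_flow2 eps : measurable_fun [set: mR * mP]
  (fun p : mR * mP => flow eps p.1 p.2 : mP).
Proof. by rewrite /flow; measurability. Qed.

Lemma measurable_flow eps s : measurable_fun [set: mP] (flow eps s : mP -> mP).
Proof.
by apply: (measurableT_comp (measurable_flow2 eps) (g := fun z : mP => (s, z)));
  measurability.
Qed.

Lemma measurable_entry_point eps : measurable_fun [set: mP]
  (entry_point eps : mP -> mP).
Proof.
apply: (measurableT_comp (measurable_flow2 eps)
  (g := fun z : mP => (- entry_time eps z, z))).
apply: measurable_fun_pair => //.
apply: (measurableT_comp (@oppr_measurable _ setT)).
exact: measurable_entry_time.
Qed.

Lemma measurable_disk : measurable (@disk R : set mR2).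
Proof.
have -> : @disk R = (fun x => dotp x x) @^-1` `]-oo, 1].
  by apply/seteqP; split => x /=; rewrite in_itv/= => /diskE.
rewrite -[X in measurable X]setTI.
have : measurable_fun [set: mR2] (fun x : mR2 => dotp x x : R).
  by rewrite /dotp; measurability.
by apply => //; exact: measurable_itv.
Qed.

Lemma measurable_unit_circle : measurable (@unit_circle R : set mR2).
Proof.
have -> : @unit_circle R = (fun x => dotp x x) @^-1` [set 1].
  by apply/seteqP; split => x /unit_circleE.
rewrite -[X in measurable X]setTI.
have : measurable_fun [set: mR2] (fun x : mR2 => dotp x x : R).
  by rewrite /dotp; measurability.
by apply => //; exact: measurable_set1.
Qed.

Lemma measurable_phase_domain : measurable (@phase_domain R : set mP).
Proof.
have -> : @phase_domain R = ([set t | 0 <= t] `*` @disk R) `*` @unit_circle R.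
  by apply/seteqP; split => [z []|z [[]]].
apply: measurableX; last exact: measurable_unit_circle.
apply: measurableX; last exact: measurable_disk.
by rewrite -set_itv_c_infty; exact: measurable_itv.
Qed.

Lemma measurable_initial_domain : measurable (@initial_domain R : set (mR2 * mR2)).
Proof. apply: measurableX; [exact: measurable_disk|exact: measurable_unit_circle]. Qed.

Lemma measurable_boundary_domain : measurable (@boundary_domain R : set mP).
Proof.
have -> : @boundary_domain R = (([set t | 0 <= t] `*` @unit_circle R) `*` @unit_circle R)
    `&` (fun z => dotp z.2 z.1.2) @^-1` [set r | r < 0].
  by apply/seteqP; split => [z [? []]|z [[[? ?] ?] ?]].
apply: measurableI.
  apply: measurableX; last exact: measurable_unit_circle.
  apply: measurableX; last exact: measurable_unit_circle.
  by rewrite -set_itv_c_infty; exact: measurable_itv.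
rewrite -[X in measurable X]setTI.
have : measurable_fun [set: mP] (fun z : mP => dotp z.2 z.1.2 : R).
  by rewrite /dotp; measurability.
by apply => //; rewrite -set_itv_infty_o; exact: measurable_itv.
Qed.

End measurability.

(** * Characteristics and null sets *)

Section flow_null.
Context {R : realType}.
Local Notation mR := (measurableTypeR R).
Local Notation mR2 := (mR * mR)%type.
Local Notation mR3 := (mR * mR2)%type.
Local Notation mP := (mR * mR2 * mR2)%type.
Local Notation mu := (@lebesgue_measure R).
Implicit Types eps s : R.

Lemma measurable_addr (a : R) : measurable_fun [set: mR] (fun x : mR => x + a : mR).
Proof. measurability. Qed.

Lemma ae_plane_translate (a b : R) (P : mR2 -> Prop) :
  {ae plane_measure, forall x, P x} ->
  {ae plane_measure, forall x, P (x.1 + a, x.2 + b)}.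
Proof.
apply: (@ae_prod_map _ _ _ _ _ _ _ _ R mu mu mu mu (fun x => x + a) (fun x => x + b));
  by [exact: measurable_addr|move=> Q; exact: ae_translate].
Qed.

Lemma ae_time_plane_translate (c a b : R) (P : mR3 -> Prop) :
  {ae time_plane_measure, forall x, P x} ->
  {ae time_plane_measure, forall x, P (x.1 + c, (x.2.1 + a, x.2.2 + b))}.
Proof.
apply: (@ae_prod_map _ _ _ _ _ _ _ _ R mu mu plane_measure plane_measure
  (fun x => x + c) (fun x => (x.1 + a, x.2 + b))).
- exact: measurable_addr.
- measurability.
- by move=> Q; exact: ae_translate.
- by move=> Q; exact: ae_plane_translate.
Qed.

(** For a fixed velocity the flow is a translation. *)
Lemma ae_flow eps s (P : mP -> Prop) :
  {ae phase_measure, forall z, P z} -> {ae phase_measure, forall z, P (flow eps s z)}.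
Proof.
move=> aeP; have := @ae_skew_y _ _ _ mR3 mR3 mR2 R time_plane_measure
  time_plane_measure arc_measure
  (fun w x => (x.1 + s * eps ^+ 2,
     (x.2.1 + s * (eps * w.1), x.2.2 + s * (eps * w.2)))) setT.
move=> /(_ _ measurableT _ P aeP); move=> h.
have {}h := h (measurable_flow eps s).
suff : {ae (time_plane_measure \x arc_measure)%E, forall z : mP,
    setT z -> P (flow eps s z)}.
  by apply: ae_imply => z; apply.
apply: h; apply: aeW => w Q aeQ.
have := ae_time_plane_translate (s * eps ^+ 2) (s * (eps * w.1)) (s * (eps * w.2)) aeQ.
by apply: ae_imply => x Qx _.
Qed.

Lemma ae_flow_ae eps (P : mP -> Prop) :
  {ae phase_measure, forall z, P z} ->
  {ae phase_measure, forall z, {ae mu, forall s, P (flow eps s z)}}.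
Proof.
move=> /aeP[N mN [aeN NP]].
pose F : mP * mR -> mP := fun p => flow eps p.2 p.1.
have mF : measurable_fun setT F.
  by apply: (measurableT_comp (measurable_flow2 eps)
    (g := fun p : mP * mR => (p.2, p.1))); measurability.
have mFN : measurable (F @^-1` N).
  by rewrite -[X in measurable X]setTI; exact: mF.
have : {ae (phase_measure \x mu)%E, forall p, ~ (F @^-1` N) p}.
  by apply/ae_prod_yP => //; apply: aeW => s; exact: (ae_flow eps s aeN).
move=> /ae_prod_x; apply: ae_imply => z; apply: ae_imply => s; exact: NP.
Qed.

(** By Fubini the set of (z, s) with [flow eps s z] in [N] is null, so some section
at fixed s is null, and the flow carries it back to [N]. *)
Lemma ae_of_ae_flow eps (N : set mP) : measurable N ->
  (forall z, {ae mu, forall s, ~ N (flow eps s z)}) ->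
  {ae phase_measure, forall z, ~ N z}.
Proof.
move=> mN aeN.
pose F : mP * mR -> mP := fun p => flow eps p.2 p.1.
have mF : measurable_fun setT F.
  by apply: (measurableT_comp (measurable_flow2 eps)
    (g := fun p : mP * mR => (p.2, p.1))); measurability.
have mFN : measurable (F @^-1` N).
  by rewrite -[X in measurable X]setTI; exact: mF.
have : {ae (phase_measure \x mu)%E, forall p, ~ (F @^-1` N) p}.
  by apply/ae_prod_xP => //; apply: aeW => z; exact: aeN.
move=> /ae_prod_y aes.
have muT : (0 < mu [set: R])%E.
  apply: (@lt_le_trans _ _ (mu `[0, 1])).
    by rewrite lebesgue_measure_itv/= lte_fin ltr01 -EFinB subr0 lte_fin ltr01.
  by apply: le_measure => //; rewrite inE.
have [s] : exists s, {ae phase_measure, forall z, ~ (F @^-1` N) (z, s)}.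
  have PF := ae_properfilter_algebraOfSetsType muT.
  exact: (@filter_ex _ _ PF _ aes).
move=> /(ae_flow eps (- s)); apply: ae_imply => z.
by rewrite /F/= flowD addNr flow0.
Qed.

Lemma ae_phase_of_time_plane (P : mR3 -> Prop) :
  {ae time_plane_measure, forall x, P x} ->
  {ae phase_measure, forall z : mP, P z.1}.
Proof. exact: (ae_prod_fst arc_measure). Qed.

End flow_null.

(** * Traces of null sets of the boundary data *)

Lemma derive_bounded_increment (R : realType) (f df : R -> R) (L a b : R) :
  a <= b -> (forall x : R, is_derive x 1 f (df x)) ->
  (forall x, a <= x <= b -> `|df x| <= L) -> `|f b - f a| <= L * (b - a).
Proof.
move=> ab fdf dfL.
have fc : {within `[a, b], continuous f}.
  by apply: derivable_within_continuous => x _; exact: @ex_derive _ _ _ _ _ _ _ (fdf x).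
have [c + ->] := MVT_segment ab (fun x _ => fdf x) fc.
rewrite in_itv/= => cab.
by rewrite normrM [X in _ * X]ger0_norm ?subr_ge0// ler_wpM2r ?subr_ge0// dfL.
Qed.

Section circle.
Context {R : realType}.
Local Notation mR := (measurableTypeR R).
Local Notation mR2 := (mR * mR)%type.
Local Notation mR3 := (mR * mR2)%type.
Local Notation mP := (mR * mR2 * mR2)%type.
Local Notation mu := (@lebesgue_measure R).

Lemma circle_param_unit (a : R) : unit_circle (circle_param a).
Proof. by apply/unit_circleE; rewrite /dotp /circle_param/= -!expr2 cos2Dsin2. Qed.

(** The angle is acos of the first coordinate, reflected when the second one is
negative. *)
Lemma circle_param_onto (x : R * R) : unit_circle x ->
  exists2 a, 0 <= a < 2 * pi & circle_param a = x.
Proof.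
case: x => x1 x2 /unit_circleE; rewrite /dotp/= -!expr2 => xE.
have pi0 := pi_gt0 R.
have x1b : -1 <= x1 <= 1.
  by rewrite -ler_norml -sqrtr_sqr -[leRHS]sqrtr1 ler_wsqrtr// -xE lerDl sqr_ge0.
have x2E : Num.sqrt (1 - x1 ^+ 2) = `|x2| by rewrite -xE addrC addKr sqrtr_sqr.
have [x20|x20] := leP 0 x2.
  exists (acos x1).
    by rewrite acos_ge0//= (le_lt_trans (acos_lepi x1b))//; lra.
  by rewrite /circle_param acosK ?in_itv// sin_acos// x2E ger0_norm.
have x11 : x1 < 1.
  rewrite lt_neqAle; case/andP: x1b => _ ->; rewrite andbT; apply/eqP => x11.
  have /eqP : x2 ^+ 2 = 0 by move: xE; rewrite x11 expr1n; lra.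
  by rewrite sqrf_eq0 lt_eqF.
exists (pi *+ 2 - acos x1).
  have a0 : 0 < acos x1 by apply: acos_gt0; case/andP: x1b => ->.
  have := acos_lepi x1b; rewrite mulr2n => a1; apply/andP; split; lra.
rewrite /circle_param addrC cosD2pi sinD2pi cosN sinN acosK ?in_itv//.
by rewrite sin_acos// x2E ltr0_norm// opprK.
Qed.

Lemma ae_arcP (N : set mR2) : measurable N ->
  {ae arc_measure, forall x, ~ N x} <->
  {ae mu, forall a, 0 <= a < 2 * pi -> ~ N (circle_param a)}.
Proof.
move=> mN; rewrite ae_measure0//.
have mc : measurable ((@circle_param R : mR -> mR2) @^-1` N).
  rewrite -[X in measurable X]setTI.
  exact: measurable_circle_param.
rewrite /arc_measure /pushforward /mrestr/= -(@ae_measure0 _ _ _ mu).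
  split; apply: ae_imply => a.
    by move=> aN a01 Na; apply: aN; split => //=; rewrite in_itv.
  by move=> aN [Na]; rewrite /= in_itv/= => /aN.
exact: measurableI.
Qed.

Lemma ae_arc_unit : {ae arc_measure, forall w : mR2, unit_circle w}.
Proof.
have mN : measurable (~` @unit_circle R : set mR2).
  by apply: measurableC; exact: measurable_unit_circle.
suff : {ae arc_measure, forall w : mR2, ~ (~` @unit_circle R) w}.
  by apply: ae_imply => w /contrapT.
by apply/ae_arcP => //; apply: aeW => a _; apply; exact: circle_param_unit.
Qed.

Lemma ae_neq2 (a b : R) : {ae mu, forall x, x <> a /\ x <> b}.
Proof.
have n1 c : {ae mu, forall x, ~ [set c] x}.
  by apply/ae_measure0; [exact: measurable_set1|exact: lebesgue_measure_set1].
exact: ae_imply2 (n1 a) (n1 b).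
Qed.

Lemma ae_arc_nonhorizontal : {ae arc_measure, forall w : mR2, w.2 <> 0}.
Proof.
pose N : set mR2 := (fun w : mR2 => w.2 : R) @^-1` [set 0].
have mN : measurable N.
  have m2 : measurable_fun [set: mR2] (fun w : mR2 => w.2 : R) := measurable_snd.
  by rewrite -[X in measurable X]setTI; apply: m2 => //; exact: measurable_set1.
suff : {ae arc_measure, forall w : mR2, ~ N w} by [].
apply/ae_arcP => //; have := ae_neq2 0 pi.
apply: ae_imply => a [a0 api] /andP[age alt].
rewrite /N/=; apply/eqP.
have [apilt|apile] := ltP a pi.
  rewrite gt_eqF// sin_gt0_pi// apilt andbT lt_neqAle age andbT.
  by apply/eqP => /esym.
have -> : a = (a - pi) + pi by rewrite subrK.
rewrite sinDpi oppr_eq0 gt_eqF// sin_gt0_pi//; apply/andP; split; last by lra.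
rewrite subr_gt0 lt_neqAle apile andbT; apply/eqP => /esym //.
Qed.

Definition chord_entry (w x : R * R) : R * R :=
  (x.1 - entry_distance x w * w.1, x.2 - entry_distance x w * w.2).

Lemma unit_circle_chord_entry (w x : R * R) : disk x -> unit_circle w ->
  unit_circle (chord_entry w x).
Proof.
move=> xD w1; apply/unit_circleE.
have := @sqnorm_flow R 1 (- entry_distance x w) (0, x, w) w1.
rewrite /flow/= !mul1r !mulNr mulr1 -/(chord_entry w x) => ->.
have := discr_disk_ge0 w xD => d0.
have : Num.sqrt (discr x w) ^+ 2 = discr x w by rewrite sqr_sqrtr.
rewrite /entry_distance; move: (Num.sqrt _) => q; rewrite /discr => qE.
rewrite sqrrN sqrrD qE; ring.
Qed.

(** Chords of direction w are the level sets of x1 - x2 w1 / w2, which on the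
circle is a Lipschitz function of the angle. Hence for fixed x2 the abscissas x1
whose chord enters through a null set of angles form a null set. *)
Lemma ae_chord_entry (w : R * R) (P : mR2 -> Prop) : unit_circle w -> w.2 <> 0 ->
  {ae arc_measure, forall x, P x} ->
  {ae plane_measure, forall x : mR2, disk x -> P (chord_entry w x)}.
Proof.
move=> w1 w20 /aeP[N mN [/(ae_arcP mN) aeN NP]].
have mdist : measurable_fun [set: mR2] (fun x : mR2 => entry_distance x w : R).
  apply: (measurableT_comp measurable_entry_distance
    (g := fun x : mR2 => (x, w))).
  by measurability.
have mF : measurable_fun [set: mR2] (chord_entry w : mR2 -> mR2).
  apply: measurable_fun_pair; (apply: measurable_funB; first by measurability);
    (apply: measurable_funM; [exact: mdist|exact: measurable_cst]).
suff : {ae plane_measure, forall x, ~ (@disk R `&` chord_entry w @^-1` N) x}.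
  by apply: ae_imply => x xN xD; apply: NP => xN'; exact: xN.
have mS : measurable (@disk R `&` chord_entry w @^-1` N : set mR2).
  apply: measurableI; first exact: measurable_disk.
  by rewrite -[X in measurable X]setTI; exact: mF.
apply/(ae_prod_yP mu mu mS); apply: aeW => x2.
pose k := w.1 / w.2.
(* [f] maps the angle at which a chord enters to its abscissa at height [x2]. *)
pose f (a : R) := x2 * k + (cos a - k * sin a).
have f' (a : R) : is_derive a 1 f (- sin a - k * cos a).
  rewrite /f; apply: is_derive_eq.
  by rewrite add0r mul1r.
have k0 : 0 < 1 + `|k| by rewrite ltr_pwDl.
have f'L (a : R) : `|- sin a - k * cos a| <= 1 + `|k|.
  rewrite (le_trans (ler_normB _ _))// normrN lerD ?sin_max// normrM.
  by rewrite -[leRHS]mulr1 ler_wpM2l// cos_max.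
have fL (x y : R) : `|f x - f y| <= (1 + `|k|) * `|x - y|.
  wlog xy : x y / y <= x => [hw|].
    have [|/ltW] := leP y x; first exact: hw.
    by move=> /hw; rewrite distrC [in leRHS]distrC.
  rewrite [`|x - y|]ger0_norm ?subr_ge0//.
  exact: (derive_bounded_increment xy f' (fun z _ => f'L z)).
have := negligible_lipschitz_image k0 fL aeN.
apply: negligibleS => x1 /= /contrapT[xD xN].
have /circle_param_onto[a a01 aE] := unit_circle_chord_entry xD w1.
exists a; first by apply/not_implyP; split => //; rewrite aE => /(_ xN).
move: aE => /(congr1 (fun p => p.1 - k * p.2)).
rewrite /circle_param /chord_entry/= /f => ->.
by rewrite /k; field; exact/eqP.
Qed.

End circle.

Section trace.
Context {R : realType}.
Local Notation mR := (measurableTypeR R).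
Local Notation mR2 := (mR * mR)%type.
Local Notation mR3 := (mR * mR2)%type.
Local Notation mP := (mR * mR2 * mR2)%type.
Local Notation mu := (@lebesgue_measure R).
Implicit Types eps : R.

Lemma measurable_chord_entry :
  measurable_fun [set: mR2 * mR2] (fun p => chord_entry p.1 p.2 : mR2).
Proof.
have md : measurable_fun [set: mR2 * mR2]
    (fun p : mR2 * mR2 => entry_distance p.2 p.1 : R).
  apply: (measurableT_comp measurable_entry_distance
    (g := fun p : mR2 * mR2 => (p.2, p.1))).
  by measurability.
apply: measurable_fun_pair; (apply: measurable_funB; first by measurability);
  (apply: measurable_funM; [exact: md|by measurability]).
Qed.

(** The map first translates t by an amount depending on x only, then moves x along
its chord; each of the two preserves null sets. *)
Lemma ae_time_chord_entry (eps : R) (w : R * R) (P : mR3 -> Prop) :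
  unit_circle w -> w.2 <> 0 -> {ae time_arc_measure, forall x, P x} ->
  {ae time_plane_measure, forall y : mR3, disk y.2 ->
    P (y.1 - eps * entry_distance y.2 w, chord_entry w y.2)}.
Proof.
move=> w1 w20 aeP.
have mchord : measurable_fun [set: mR2] (chord_entry w : mR2 -> mR2).
  by apply: (measurableT_comp measurable_chord_entry (g := fun x : mR2 => (w, x)));
    measurability.
have mdist : measurable_fun [set: mR3] (fun y : mR3 => entry_distance y.2 w : R).
  apply: (measurableT_comp measurable_entry_distance
    (g := fun y : mR3 => (y.2, w))).
  by measurability.
have mD : measurable ([set y | disk y.2] : set mR3).
  rewrite -[X in measurable X]setTI.
  by apply: (@measurable_snd _ _ mR mR2) => //; exact: measurable_disk.
have aeP1 : {ae time_plane_measure, forall y : mR3, disk y.2 ->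
    P (y.1, chord_entry w y.2)}.
  apply: (@ae_skew_x _ _ _ mR mR2 mR2 R mu plane_measure arc_measure
    (fun _ x => chord_entry w x) [set y | disk y.2]) => //.
    apply: measurable_fun_pair; first by measurability.
    by apply: (measurableT_comp mchord); measurability.
  apply: aeW => t Q aeQ; exact: ae_chord_entry.
have := @ae_skew_y _ _ _ mR mR mR2 R mu mu plane_measure
    (fun x t => t - eps * entry_distance x w) [set y | disk y.2].
move=> /(_ _ _ _ _ aeP1) h.
suff : {ae time_plane_measure, forall y : mR3, disk y.2 -> disk y.2 ->
    P (y.1 - eps * entry_distance y.2 w, chord_entry w y.2)}.
  by apply: ae_imply => y yP yD; exact: yP.
apply: h => //.
  apply: measurable_fun_pair; last by measurability.
  apply: measurable_funB; first by measurability.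
  by apply: measurable_funM; [exact: measurable_cst|exact: mdist].
apply: aeW => x Q aeQ.
by have := ae_translate (- (eps * entry_distance x w)) aeQ; apply: ae_imply.
Qed.

Lemma ae_phase_boundary eps (P : mP -> Prop) :
  {ae boundary_measure, forall z, P z} ->
  {ae phase_measure, forall z : mP, disk z.1.2 ->
    P (z.1.1 - eps * entry_distance z.1.2 z.2, chord_entry z.2 z.1.2, z.2)}.
Proof.
move=> aeP.
have := @ae_skew_y _ _ _ mR3 mR3 mR2 R time_plane_measure time_arc_measure
  arc_measure
  (fun w y => (y.1 - eps * entry_distance y.2 w, chord_entry w y.2))
  [set z | disk z.1.2].
move=> /(_ _ _ _ _ aeP); apply => //.
- apply: measurable_fun_pair; last by measurability.
  apply: measurable_fun_pair; last first.
    apply: (measurableT_comp measurable_chord_entry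
      (g := fun z : mP => (z.2, z.1.2))).
    by measurability.
  apply: measurable_funB; first by measurability.
  apply: measurable_funM; first exact: measurable_cst.
  apply: (measurableT_comp measurable_entry_distance
    (g := fun z : mP => (z.1.2, z.2))).
  by measurability.
- have mx : measurable_fun [set: mP] (fun z : mP => z.1.2 : mR2).
    by measurability.
  by rewrite -[X in measurable X]setTI; apply: mx => //; exact: measurable_disk.
- move: (@ae_arc_unit R) (@ae_arc_nonhorizontal R); apply: ae_imply2 => w w1 w2 Q aeQ.
  exact: ae_time_chord_entry.
Qed.

Lemma ae_phase_initial eps (P : mR2 * mR2 -> Prop) :
  {ae initial_measure, forall p, P p} ->
  {ae phase_measure, forall z : mP,
    P ((flow eps (- (z.1.1 / eps ^+ 2)) z).1.2, z.2)}.
Proof.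
move=> Pae.
pose phi (w : mR2) (y : mR3) : mR2 :=
  (y.2.1 + - (y.1 / eps ^+ 2) * (eps * w.1),
   y.2.2 + - (y.1 / eps ^+ 2) * (eps * w.2)).
have h := @ae_skew_y _ _ _ mR3 mR2 mR2 R time_plane_measure plane_measure
  arc_measure phi setT.
suff : {ae phase_measure, forall z : mP, setT z ->
    P ((flow eps (- (z.1.1 / eps ^+ 2)) z).1.2, z.2)}.
  by apply: ae_imply => z; apply.
have mphi : measurable_fun setT (fun z : mP => (phi z.2 z.1, z.2)).
  by rewrite /phi; measurability.
apply: (h mphi measurableT _ _ Pae).
apply: aeW => w Q /aeP[N mN [aeN NQ]].
pose F (y : mR3) : mR2 := (y.2.1 + - (y.1 / eps ^+ 2) * (eps * w.1),
               y.2.2 + - (y.1 / eps ^+ 2) * (eps * w.2)).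
have mF : measurable_fun [set: mR3] F by rewrite /F; measurability.
suff : {ae time_plane_measure, forall y, ~ (F @^-1` N) y}.
  by apply: ae_imply => y Ny _; exact: NQ.
apply/(ae_prod_xP mu plane_measure).
  by rewrite -[X in measurable X]setTI; exact: mF.
apply: aeW => t.
exact: (ae_plane_translate (- (t / eps ^+ 2) * (eps * w.1))
  (- (t / eps ^+ 2) * (eps * w.2)) aeN).
Qed.

(** A characteristic on a tangent line meets the domain at a single point. *)
Lemma ae_discr_gt0 eps : 0 < eps ->
  {ae phase_measure, forall z : mP, phase_domain z -> 0 < discr z.1.2 z.2}.
Proof.
move=> e0.
pose N : set mP := @phase_domain R `&` [set z | discr z.1.2 z.2 <= 0].
have mN : measurable N.
  apply: measurableI; first exact: measurable_phase_domain.
  have md : measurable_fun [set: mP] (fun z : mP => discr z.1.2 z.2 : R).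
    apply: (measurableT_comp measurable_discr (g := fun z : mP => (z.1.2, z.2))).
    by measurability.
  have -> : [set z : mP | discr z.1.2 z.2 <= 0] =
      setT `&` (fun z : mP => discr z.1.2 z.2 : R) @^-1` `]-oo, 0].
    by rewrite setTI; apply/seteqP; split => z /=; rewrite in_itv.
  by apply: md => //; exact: measurable_itv.
suff : {ae phase_measure, forall z, ~ N z}.
  apply: ae_imply => z zN zD; rewrite ltNge; apply/negP => d0; exact: zN.
apply: (@ae_of_ae_flow _ eps) => // z.
have := ae_neq2 (- (dotp z.1.2 z.2 / eps)) 0.
apply: ae_imply => s [se _] [] [_ xD z2] /= d0; apply: se.
have := discr_ge (flow eps s z).2 xD => h.
have : dotp (flow eps s z).1.2 z.2 == 0.
  by rewrite -sqrf_eq0 eq_le sqr_ge0 andbT (le_trans h).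
rewrite dotp_flow// addrC addr_eq0 => /eqP sE.
by rewrite -mulNr -sE mulfK// lt0r_neq0.
Qed.

(** Tangents aside, a characteristic enters through the initial plane or the in-flow
boundary, and both entry maps preserve null sets. *)
Lemma ae_entry_point eps (Pi : (R * R) * (R * R) -> Prop)
    (Pb : R * (R * R) * (R * R) -> Prop) : 0 < eps ->
  {ae initial_measure, forall p, initial_domain p -> Pi p} ->
  {ae boundary_measure, forall z, boundary_domain z -> Pb z} ->
  {ae phase_measure, forall z, phase_domain z ->
    [\/ (entry_point eps z).1.1 = 0 /\
          Pi ((entry_point eps z).1.2, (entry_point eps z).2) |
        0 < (entry_point eps z).1.1 /\ Pb (entry_point eps z)]}.
Proof.
move=> e0 /(ae_phase_initial eps) aei /(ae_phase_boundary eps) aeb.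
apply: ae_imply2 (ae_discr_gt0 e0) (filterI aei aeb) => z d0 [zi zb] zD.
have yD := phase_domain_entry_point e0 zD.
have [y0|[y0 [tE yb]]] := entry_point_cases e0 zD (d0 zD).
- left; split => //.
  have tE : entry_time eps z = z.1.1 / eps ^+ 2.
    move: y0; rewrite /entry_point /= mulNr => /eqP; rewrite subr_eq0 => /eqP ->.
    by rewrite mulfK// expf_neq0// lt0r_neq0.
  rewrite /entry_point tE; apply: zi; rewrite -tE.
  by case: yD => _ ? ?; split.
- right; split => //.
  have yE : entry_point eps z =
      (z.1.1 - eps * entry_distance z.1.2 z.2, chord_entry z.2 z.1.2, z.2).
    rewrite /entry_point /flow tE /chord_entry; congr ((_, (_, _)), _);
      by field; exact: lt0r_neq0.
  by rewrite yE; apply: zb; [case: zD|rewrite -yE].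
Qed.

End trace.

(** * Absolutely continuous functions *)

Section absolute_continuity.
Context {R : realType}.
Local Notation mu := (@lebesgue_measure R).
Implicit Types (a b e K : R) (f : R -> R).

Lemma is_derive0_increment f (x e : R) (l : R) : is_derive x 1 f l -> l <= 0 ->
  0 < e -> exists2 d, 0 < d & forall h, `|h| < d -> h != 0 -> (f (x + h) - f x) / h <= e.
Proof.
move=> [df fl] l0 e0.
have : h^-1 *: (f (h + x) - f x) @[h --> 0^'] --> l.
  have := df; rewrite /derivable -/('D_1 f x) => /cvg_ex[k fk].
  move: fl; rewrite /derive => <-.
  have -> : (fun h : R => h^-1 *: (f (h + x) - f x)) =
            (fun h : R => h^-1 *: ((f \o shift x) (h *: (1 : R)) - f x)).
    by apply/funext => h /=; rewrite scaler1.
  exact: df.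
move=> /cvgrPdist_lt/(_ e e0)[d/= d0 dl].
exists d => // h hd h0; have := dl h.
rewrite /ball_ /= sub0r normrN => /(_ hd h0).
rewrite ltr_norml => /andP[+ _].
rewrite -[_ *: _]/(_ * _) mulrC [h + x]addrC; lra.
Qed.

Lemma AC_step a b f : absolutely_continuous a b f -> forall e, 0 < e ->
  exists2 d, 0 < d & forall x y, a <= x -> x <= y -> y <= b -> y - x < d ->
    `|f y - f x| < e.
Proof.
move=> fAC e e0; have [d d0 df] := fAC e e0; exists d => // x y ax xy yb yxd.
have := df 1%N (fun=> (x, y)); rewrite !big_ord1; apply => //.
by move=> i j _ _ _; rewrite !ord1.
Qed.

(** Each step shorter than the d of absolute continuity for e = 1 changes [f] by less
than 1, and boundedly many such steps cross the interval. *)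
Lemma AC_bounded a b f : absolutely_continuous a b f ->
  exists M, forall x, a <= x <= b -> `|f x| <= M.
Proof.
move=> /AC_step /(_ 1 ltr01)[d d0 df].
have fn n x : a <= x <= b -> x - a <= n%:R * (d / 2) -> `|f x| <= `|f a| + n%:R.
  elim: n x => [|n IH] x /andP[ax xb].
    rewrite mul0r addr0 subr_le0 => xa; have -> // : x = a by apply/le_anti/andP.
  rewrite -natr1 => xn.
  have [xn'|xn'] := leP (x - a) (n%:R * (d / 2)).
    by rewrite (le_trans (IH x _ xn')) ?ax//; lra.
  pose y := x - d / 2.
  have nd : 0 <= n%:R * (d / 2) by rewrite mulr_ge0// ltW// divr_gt0.
  have [ay|ya] := leP a y.
    have fy : `|f y| <= `|f a| + n%:R.
      by move: ay; rewrite /y => ay; apply: IH; [apply/andP; split|]; lra.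
    have : `|f x - f y| < 1 by move: ay; rewrite /y => ay; apply: df; lra.
    have := ler_normD (f x - f y) (f y); rewrite subrK; lra.
  have : `|f x - f a| < 1 by move: ya; rewrite /y => ya; apply: df; lra.
  have := ler_normD (f x - f a) (f a); rewrite subrK.
  have : 0 <= n%:R :> R by []. lra.
have [n] : exists n, (b - a) / (d / 2) <= n%:R.
  exists (Num.truncn ((b - a) / (d / 2))).+1; apply: ltW.
  exact: truncnS_gt.
rewrite ler_pdivrMr ?divr_gt0// => ban.
exists (`|f a| + n%:R) => x axb; apply: fn => //; lra.
Qed.

Lemma AC_mul_expR a b K f : absolutely_continuous a b f ->
  absolutely_continuous a b (fun s => expR s * (f s - K)).
Proof.
move=> fAC; have [M Mf] := AC_bounded fAC.
pose B := expR b * (`|M| + `|K| + 1).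
have B0 : 0 < B by rewrite mulr_gt0 ?expR_gt0// ltr_wpDl// addr_ge0.
move=> e e0.
have e2 : 0 < e / 2 / expR b by rewrite !divr_gt0// expR_gt0.
have [d d0 df] := fAC _ e2.
exists (Num.min d (e / 2 / B)) => [|n I Iab Itriv]; first by rewrite lt_min d0 !divr_gt0.
rewrite lt_min => /andP[Id IB].
have := df n I Iab Itriv Id => fe.
have step i : `|expR (I i).2 * (f (I i).2 - K) - expR (I i).1 * (f (I i).1 - K)| <=
    expR b * `|f (I i).2 - f (I i).1| + B * ((I i).2 - (I i).1).
  have [a1 i12 b2] := Iab i.
  have -> : expR (I i).2 * (f (I i).2 - K) - expR (I i).1 * (f (I i).1 - K) =
    expR (I i).2 * (f (I i).2 - f (I i).1) +
    (expR (I i).2 - expR (I i).1) * (f (I i).1 - K).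
    by ring.
  rewrite (le_trans (ler_normD _ _))// !normrM lerD//.
    by rewrite ger0_norm ?expR_ge0// ler_wpM2r// ler_expR.
  rewrite /B mulrAC ler_pM//.
    apply: (@derive_bounded_increment R expR expR) => // x /andP[_ xi].
    by rewrite ger0_norm ?expR_ge0// ler_expR (le_trans xi).
  rewrite (le_trans (ler_normB _ _))// -[leLHS]addr0 lerD// lerD2r.
  by rewrite (le_trans (Mf _ _)) ?ler_norm// a1 (le_trans i12).
apply: (@le_lt_trans _ _ (\sum_(i < n)
   (expR b * `|f (I i).2 - f (I i).1| + B * ((I i).2 - (I i).1)))).
  exact: ler_sum.
rewrite big_split/= -!mulr_sumr [e]splitr.
by rewrite ltrD// -ltr_pdivlMl ?expR_gt0// mulrC.
Qed.

End absolute_continuity.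

Section AC_monotone.
Context {R : realType}.
Local Notation mu := (@lebesgue_measure R).
Implicit Types (a b e K : R) (f : R -> R) (U : set R).

(** What a finite partition of [[a, x]] whose intervals are either contained in
    [U] or of slope at most [e] achieves: [s] lists the former. *)
Definition chain_bound f U a e x := exists s : seq (R * R),
  [/\ forall p, p \in s -> [/\ a <= p.1, p.1 <= p.2, p.2 <= x & `]p.1, p.2[ `<=` U],
      pairwise (fun p q => q.2 <= p.1) s,
      ((\sum_(p <- s) (p.2 - p.1))%:E <= mu (U `&` `]-oo, x[))%E &
      f x - f a <= e * (x - a) + \sum_(p <- s) `|f p.2 - f p.1|].

Lemma chain_bound_slope f U a e x y : open U -> x <= y ->
  f y - f x <= e * (y - x) -> chain_bound f U a e x -> chain_bound f U a e y.
Proof.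
move=> oU xy fxy [s [s1 s2 s3 s4]]; exists s; split => //.
- by move=> p /s1[? ? px ?]; split => //; exact: le_trans px xy.
- apply: le_trans s3 _; apply: le_measure; rewrite ?inE.
  + by apply: measurableI; [exact: open_measurable|exact: measurable_itv].
  + by apply: measurableI; [exact: open_measurable|exact: measurable_itv].
  + by move=> r [Ur]; rewrite /= !in_itv/= => rx; split => //; exact: lt_le_trans rx xy.
- lra.
Qed.

Lemma chain_bound_cover f U a e x y : open U -> 0 <= e -> a <= x -> x <= y ->
  `]x, y[ `<=` U -> chain_bound f U a e x -> chain_bound f U a e y.
Proof.
move=> oU e0 ax xy xyU [s [s1 s2 s3 s4]]; exists ((x, y) :: s); split => //.
- move=> p; rewrite inE => /orP[/eqP ->//|/s1[? ? px ?]].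
  by split => //; exact: le_trans px xy.
- rewrite /= s2 andbT; apply/allP => p /s1[]//.
- rewrite big_cons EFinD.
  apply: (@le_trans _ _ (mu `]x, y[ + mu (U `&` `]-oo, x[)))%E.
    rewrite leeD// lebesgue_measure_itv/= lte_fin.
    by case: ltP => // yx; rewrite lee_fin; lra.
  have mU z : measurable (U `&` `]-oo, z[).
    by apply: measurableI; [exact: open_measurable|exact: measurable_itv].
  have mxy : measurable `]x, y[ by exact: measurable_itv.
  rewrite -measureU//; last first.
    rewrite -subset0 => r [] /=; rewrite in_itv/= => /andP[xr _] [_].
    by rewrite in_itv/= => /(lt_trans xr); rewrite ltxx.
    exact: mU.
  apply: le_measure; rewrite ?inE;
    [exact: measurableU mxy (mU x)|exact: mU|].
  move=> r [|[Ur]]; rewrite /= !in_itv/=.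
    by move=> /andP[xr ry]; split => //; apply: xyU; rewrite /= in_itv/= xr.
  by move=> rx; split => //; exact: lt_le_trans rx xy.
- rewrite big_cons/=; have := ler_norm (f y - f x).
  have : 0 <= e * (y - x) by rewrite mulr_ge0// subr_ge0.
  lra.
Qed.

(** Cover the null set where the derivative is not controlled by an open set [U]
    of small measure; every other point controls the slope of [f] nearby. By the
    least upper bound argument, [[a, b]] splits into finitely many intervals of
    slope at most [e] and finitely many intervals inside [U], and absolute
    continuity bounds the contribution of the latter by [e]. *)
Lemma AC_nonincreasing a b f : a <= b -> absolutely_continuous a b f ->
  {ae mu, forall s, a < s < b -> exists2 l, is_derive s 1 f l & l <= 0} ->
  f b <= f a.
Proof.
move=> ab fAC aef.
suff fe e : 0 < e -> f b - f a <= e * (b - a) + e.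
  rewrite leNgt; apply/negP => fab.
  have ba0 : 0 < b - a + 1 by lra.
  have e0 : 0 < (f b - f a) / 2 / (b - a + 1) by rewrite !divr_gt0// subr_gt0.
  have := fe _ e0.
  have := divfK (lt0r_neq0 ba0) ((f b - f a) / 2).
  move: (_ / (b - a + 1)) => e; lra.
move=> e0; have [d d0 df] := fAC e e0.
have : mu.-negligible (~` [set s | (a < s < b ->
    exists2 l, is_derive s 1 f l & l <= 0) /\ (s <> a /\ s <> b)]).
  apply: negligibleS (negligibleU aef (ae_neq2 a b)) => x /=.
  by move=> /not_andP[?|?]; [left|right].
set N := ~` _.
move=> /negligible_outer_measure N0.
have d20 : 0 < d / 2 by rewrite divr_gt0.
have [U [oU NU]] := outer_measure_open_le N d20; rewrite N0 add0e => Ud.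
suff [s [s1 s2 s3 s4]] : chain_bound f U a e b.
  have sd : \sum_(p <- s) (p.2 - p.1) < d.
    rewrite -lte_fin; apply: le_lt_trans s3 _.
    apply: (@le_lt_trans _ _ (mu U)).
      apply: le_measure; rewrite ?inE; last by move=> ? [].
        by apply: measurableI; [exact: open_measurable|exact: measurable_itv].
      exact: open_measurable.
    by rewrite (le_lt_trans Ud)// lte_fin; lra.
  have /= := df (size s) (fun i => nth (0, 0) s i).
  have bigE (F : R * R -> R) : \sum_(i < size s) F (nth (0, 0) s i) = \sum_(p <- s) F p.
    by rewrite (big_nth (0, 0)) big_mkord.
  rewrite (bigE (fun p => p.2 - p.1)) (bigE (fun p => `|f p.2 - f p.1|)) => h.
  suff : \sum_(p <- s) `|f p.2 - f p.1| < e by lra.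
  apply: h => //.
    by move=> i; have [] := s1 _ (mem_nth (0, 0) (ltn_ord i)).
  have ltij (i j : 'I_(size s)) : (i < j)%N ->
      (nth (0, 0) s j).2 <= (nth (0, 0) s i).1.
    by move=> ij; apply: (pairwiseP (0, 0) s2); rewrite ?inE.
  move=> i j _ _ [r []] /=; rewrite !in_itv/= => /andP[ir ri] /andP[jr rj].
  case: (ltngtP i j) => [/ltij|/ltij|/val_inj//].
  - by move=> /(lt_le_trans rj)/(lt_trans ir); rewrite ltxx.
  - by move=> /(lt_le_trans ri)/(lt_trans jr); rewrite ltxx.
(* Near every point, a chain bound propagates from the left of it to its right. *)
have step x0 : a <= x0 <= b -> exists2 eta, 0 < eta & forall x y,
    a <= x -> x <= x0 -> x0 <= y -> y <= b -> x0 - x < eta -> y - x0 < eta ->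
    chain_bound f U a e x -> chain_bound f U a e y.
  move=> /andP[ax0 x0b]; have [Ux0|Ux0] := pselect (U x0).
    have /nbhs_ballP[eta /= eta0 etaU] : nbhs x0 U by exact: open_nbhs_nbhs.
    exists eta => // x y ax xx0 x0y yb xeta yeta.
    apply: chain_bound_cover => //; [exact: ltW|exact: le_trans xx0 x0y|].
    move=> r /=; rewrite in_itv/= => /andP[xr ry]; apply: etaU.
    by rewrite /ball/= ltr_distlC; apply/andP; split; lra.
  have [fx0 [x0a x0b']] : (a < x0 < b -> exists2 l, is_derive x0 1 f l & l <= 0)
      /\ x0 <> a /\ x0 <> b by apply: contrapT => x0N; apply: Ux0; exact: NU.
  have [l fl l0] : exists2 l, is_derive x0 1 f l & l <= 0.
    apply: fx0; rewrite !lt_neqAle ax0 x0b !andbT.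
    by apply/andP; split; apply/eqP => // /esym.
  have [eta eta0 slope] := is_derive0_increment fl l0 e0.
  exists eta => // x y ax xx0 x0y yb xeta yeta.
  apply: chain_bound_slope => //; first exact: le_trans xx0 x0y.
  have right : f y - f x0 <= e * (y - x0).
    have [->|yx0] := eqVneq y x0; first by rewrite !subrr mulr0.
    have yx0' : 0 < y - x0 by rewrite subr_gt0 lt_neqAle eq_sym yx0.
    have := slope (y - x0); rewrite gtr0_norm// => /(_ yeta (lt0r_neq0 yx0')).
    by rewrite ler_pdivrMr// [x0 + _]addrC subrK.
  have left : f x0 - f x <= e * (x0 - x).
    have [->|xx0'] := eqVneq x x0; first by rewrite !subrr mulr0.
    have x0x : 0 < x0 - x by rewrite subr_gt0 lt_neqAle xx0'.
    have xx : x - x0 < 0 by rewrite -oppr_gt0 opprB.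
    have := slope (x - x0); rewrite ltr0_norm// opprB => /(_ xeta).
    by rewrite lt_eqF// => /(_ isT); rewrite ler_ndivrMr// [x0 + _]addrC subrK; lra.
  lra.
pose S : set R := [set x | a <= x <= b /\ chain_bound f U a e x].
have Sa : S a.
  split; first by rewrite lexx.
  by exists [::]; split => //; rewrite !big_nil ?subrr ?mulr0 ?addr0.
have Sub : ubound S b by move=> x [/andP[]].
have supS : has_sup S by split; [exists a|exists b].
have ca : a <= sup S by apply: (sup_upper_bound supS).
have cb : sup S <= b by apply: ge_sup => //; exists a.
have [|eta eta0 stepc] := step (sup S); first by rewrite ca.
have [x [/andP[ax xb] Sx] xc] := sup_adherent eta0 supS.
have xc' : x <= sup S by apply: (sup_upper_bound supS); split => //; rewrite ax.
have [bc|cb'] := leP b (sup S + eta / 2).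
  by apply: stepc Sx => //; lra.
have : S (sup S + eta / 2).
  split; first by apply/andP; split; lra.
  by apply: stepc Sx => //; lra.
by move=> /(sup_upper_bound supS); rewrite gerDl; lra.
Qed.

(** The function e^s (f s - K) is nonincreasing, its derivative being
e^s (f' + f - K). *)
Lemma AC_duhamel_le a b K f : a <= b -> absolutely_continuous a b f -> f a = 0 ->
  {ae mu, forall s, a < s < b ->
    exists2 l, is_derive s 1 f l & `|l + f s| <= K} ->
  f b <= K * (1 - expR (a - b)).
Proof.
move=> ab fAC fa aef.
suff : expR b * (f b - K) <= expR a * (f a - K).
  rewrite fa sub0r -ler_pdivlMl ?expR_gt0// mulrA mulrN -expRN -expRD addrC.
  by rewrite [- b + a]addrC; lra.
apply: (AC_nonincreasing ab (AC_mul_expR K fAC)).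
apply: ae_imply aef => s fs /fs[l fl lK].
exists (expR s * (l + (f s - K))); last first.
  rewrite pmulr_rle0 ?expR_gt0//; have := ler_norm (l + f s); lra.
apply: is_derive_eq.
rewrite -![_ *: _]/(_ * _); ring.
Qed.

Lemma AC_opp a b f : absolutely_continuous a b f ->
  absolutely_continuous a b (fun s => - f s).
Proof.
move=> fAC e e0; have [d d0 df] := fAC e e0; exists d => // n I I1 I2 I3.
have := df n I I1 I2 I3; congr (_ < _).
by apply: eq_bigr => i _; rewrite -opprD normrN.
Qed.

Lemma AC_sub a b f g : absolutely_continuous a b f -> absolutely_continuous a b g ->
  absolutely_continuous a b (fun s => f s - g s).
Proof.
move=> fAC gAC e e0; have e2 : 0 < e / 2 by rewrite divr_gt0.
have [d d0 df] := fAC _ e2; have [d' d'0 dg] := gAC _ e2.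
exists (Num.min d d') => [|n I I1 I2]; first by rewrite lt_min d0.
rewrite lt_min => /andP[Id Id'].
apply: (@le_lt_trans _ _ (\sum_(i < n)
    (`|f (I i).2 - f (I i).1| + `|g (I i).2 - g (I i).1|))).
  apply: ler_sum => i _; apply: le_trans (ler_normB _ _).
  by rewrite le_eqVlt; apply/orP; left; apply/eqP; congr (`|_|); ring.
by rewrite big_split/= [e]splitr ltrD// ?df ?dg.
Qed.

Lemma AC_duhamel a b K f : a <= b -> absolutely_continuous a b f -> f a = 0 ->
  {ae mu, forall s, a < s < b ->
    exists2 l, is_derive s 1 f l & `|l + f s| <= K} ->
  `|f b| <= K * (1 - expR (a - b)).
Proof.
move=> ab fAC fa aef; rewrite ler_norml; apply/andP; split; last first.
  exact: AC_duhamel_le.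
rewrite lerNl; apply: (AC_duhamel_le ab (AC_opp fAC)); first by rewrite fa oppr0.
apply: ae_imply aef => s fs /fs[l fl lK].
exists (- l); first by apply: is_deriveN.
by rewrite -opprD normrN.
Qed.

End AC_monotone.

(** * Essential bounds and velocity averages *)

Section Linfty_bounds.
Context d (T : measurableType d) (R : realType) (m : {measure set T -> \bar R}).
Implicit Types (D : set T) (f : T -> R).

Lemma Linfty_norm_le D f (M : R) : 0 <= M ->
  {ae m, forall x, D x -> `|f x| <= M} -> (Linfty_norm m D f <= M%:E)%E.
Proof.
move=> M0 fM; rewrite /Linfty_norm unlock; case: ifPn => _; last by rewrite lee_fin.
apply/ess_supP; apply: ae_imply fM => x fx /=.
rewrite lee_fin patchE; case: ifPn => [/set_mem/fx//|_]; by rewrite normr0.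
Qed.

Lemma Linfty_norm_fineK D f : (Linfty_norm m D f < +oo)%E ->
  (fine (Linfty_norm m D f))%:E = Linfty_norm m D f.
Proof. by move=> foo; rewrite fineK// ge0_fin_numE// Lnorm_ge0. Qed.

Lemma ae_le_Linfty_norm D f : (Linfty_norm m D f < +oo)%E ->
  {ae m, forall x, D x -> `|f x| <= fine (Linfty_norm m D f)}.
Proof.
move=> foo.
have [mT|mT] := boolP (0 < m setT)%E; last first.
  by apply: measure0_ae; apply/eqP; rewrite -measure_le0 leNgt.
have : {ae m, forall x, (`|(f \_ D) x|%:E <= Linfty_norm m D f)%E}.
  rewrite /Linfty_norm unlock mT.
  exact: (ess_sup_ge m (abse \o (EFin \o (f \_ D)))).
apply: ae_imply => x; rewrite -Linfty_norm_fineK// lee_fin patchE => + Dx.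
by rewrite mem_set.
Qed.

Lemma fine_Linfty_norm_ge0 D f : 0 <= fine (Linfty_norm m D f).
Proof. by rewrite fine_ge0// Lnorm_ge0. Qed.

End Linfty_bounds.

Section average.
Context {R : realType}.
Local Notation mR := (measurableTypeR R).
Local Notation mR2 := (mR * mR)%type.
Local Notation mR3 := (mR * mR2)%type.
Local Notation mP := (mR * mR2 * mR2)%type.
Local Notation mu := (@lebesgue_measure R).
Implicit Types (f g : mR2 -> R) (K : R).

Definition average f : R := (2 * pi)^-1 * Rintegral arc_measure unit_circle f.

Lemma arc_measure_unit_circle :
  (@arc_measure R unit_circle <= (2 * pi)%:E)%E.
Proof.
rewrite /arc_measure /pushforward /mrestr.
apply: (@le_trans _ _ (mu `[0, 2 * pi[)).
  apply: le_measure; rewrite ?inE//.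
  apply: measurableI => //; rewrite -[X in measurable X]setTI.
  by apply: measurable_circle_param => //; exact: measurable_unit_circle.
rewrite lebesgue_measure_itv/= lte_fin mulr_gt0 ?pi_gt0// -EFinB lee_fin; lra.
Qed.

Lemma integral_unit_circle_le f K : measurable_fun unit_circle f ->
  {ae arc_measure, forall w, unit_circle w -> `|f w| <= K} -> 0 <= K ->
  (\int[arc_measure]_(w in unit_circle) `|(f w)%:E| <= (K * (2 * pi))%:E)%E.
Proof.
move=> mf fK K0; have mC := @measurable_unit_circle R.
apply: (@le_trans _ _ (\int[arc_measure]_(w in unit_circle) K%:E)%E).
  apply: ae_ge0_le_integral => //.
  - by apply/measurable_EFinP; apply: measurableT_comp.
by rewrite integral_cst// EFinM lee_wpmul2l// ?lee_fin// arc_measure_unit_circle.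
Qed.

Lemma integrable_unit_circle f K : measurable_fun unit_circle f ->
  {ae arc_measure, forall w, unit_circle w -> `|f w| <= K} -> 0 <= K ->
  arc_measure.-integrable unit_circle (EFin \o f).
Proof.
move=> mf fK K0; apply/integrableP; split; first exact/measurable_EFinP.
by apply: le_lt_trans (integral_unit_circle_le mf fK K0) _; rewrite ltry.
Qed.

Lemma le_average f K : measurable_fun unit_circle f ->
  {ae arc_measure, forall w, unit_circle w -> `|f w| <= K} -> 0 <= K ->
  `|average f| <= K.
Proof.
move=> mf fK K0; have mC := @measurable_unit_circle R.
have pi2 : 0 < 2 * pi :> R by rewrite mulr_gt0// pi_gt0.
rewrite /average normrM ger0_norm ?invr_ge0 ?(ltW pi2)//.
rewrite mulrC ler_pdivrMr// -lee_fin.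
rewrite EFin_normr_Rintegral//; last exact: integrable_unit_circle fK _.
apply: le_trans (integral_unit_circle_le mf fK K0).
by apply: le_abse_integral => //; exact/measurable_EFinP.
Qed.

Lemma averageB f g K L : measurable_fun unit_circle f ->
  measurable_fun unit_circle g ->
  {ae arc_measure, forall w, unit_circle w -> `|f w| <= K} -> 0 <= K ->
  {ae arc_measure, forall w, unit_circle w -> `|g w| <= L} -> 0 <= L ->
  average f - average g = average (fun w => f w - g w).
Proof.
move=> mf mg fK K0 gL L0; have mC := @measurable_unit_circle R.
rewrite /average -mulrBr RintegralB//.
- exact: integrable_unit_circle fK K0.
- exact: integrable_unit_circle gL L0.
Qed.

Lemma measurable_velocity_section (u : mP -> R) t x :
  measurable_fun (@phase_domain R) u -> 0 <= t -> disk x ->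
  measurable_fun unit_circle (fun w : mR2 => u (t, x, w)).
Proof.
move=> mu_ t0 xD.
have /(measurable_restrictT _ (@measurable_phase_domain R)) mu' := mu_.
have : measurable_fun [set: mR2] (fun w : mR2 => (u \_ phase_domain) (t, x, w)).
  apply: (measurableT_comp mu' (g := fun w : mR2 => (t, x, w))).
  by measurability.
move=> /(measurable_funS measurableT (@subsetT _ unit_circle)).
apply: eq_measurable_fun => w /set_mem w1.
by rewrite patchE mem_set.
Qed.

End average.

(** * Uniqueness *)

Section uniqueness.
Context {R : realType}.
Local Notation mR := (measurableTypeR R).
Local Notation mR2 := (mR * mR)%type.
Local Notation mR3 := (mR * mR2)%type.
Local Notation mP := (mR * mR2 * mR2)%type.
Local Notation mu := (@lebesgue_measure R).
Implicit Types (eps K s : R) (u v : R * (R * R) * (R * R) -> R).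

(** Lets derivatives along the transport direction be computed from functions of one
variable. *)
Lemma flow_difference_quotient eps u (z : R * (R * R) * (R * R)) s :
  (fun h : R => h^-1 *: ((u \o shift (flow eps s z))
       (h *: transport_direction eps z.2) - u (flow eps s z))) =
  (fun h : R => h^-1 *: (((fun r => u (flow eps r z)) \o shift s) (h *: (1 : R))
       - u (flow eps s z))).
Proof.
apply/funext => h /=; congr (_ *: (u _ - _)).
by rewrite addrC -[z.2]/((flow eps s z).2) flowE flowD scaler1 addrC.
Qed.

Lemma is_derive_flow eps u (z : R * (R * R) * (R * R)) s :
  derivable u (flow eps s z) (transport_direction eps z.2) ->
  is_derive s 1 (fun r => u (flow eps r z))
    ('D_(transport_direction eps z.2) u (flow eps s z)).
Proof.
rewrite /derivable /derive flow_difference_quotient => uz.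
by apply: DeriveDef.
Qed.

Lemma derive_of_flow eps u (z : R * (R * R) * (R * R)) l :
  is_derive (0 : R) 1 (fun r => u (flow eps r z)) l ->
  derivable u z (transport_direction eps z.2) /\
  'D_(transport_direction eps z.2) u z = l.
Proof.
move=> [uz <-]; move: uz; rewrite /derivable /derive.
by have := flow_difference_quotient eps u z 0; rewrite flow0 => ->.
Qed.

(** The average of the difference is at most [K]; the Duhamel estimate along
characteristics of length at most 2 / eps improves the bound on the difference. *)
Lemma contraction eps g h u v K : 0 < eps ->
  transport_solution eps g h u -> transport_solution eps g h v -> 0 <= K ->
  {ae phase_measure, forall z, phase_domain z -> `|u z - v z| <= K} ->
  {ae phase_measure, forall z, phase_domain z ->
    `|u z - v z| <= (1 - expR (- (2 / eps))) * K}.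
Proof.
have eqlin (a b c a' b' c' : R) : a + b - c = 0 -> a' + b' - c' = 0 ->
    c - c' = a - a' + (b - b') by lra.
move=> e0 [[mu_ uoo] uAC uE ui ub] [[mv voo] vAC vE vi vb] K0 uvK.
have aeu := ae_le_Linfty_norm uoo; have aev := ae_le_Linfty_norm voo.
(* By Fubini, the bound holds for almost every velocity at almost every (t, x). *)
have aeavg : {ae phase_measure, forall z : mP, phase_domain z ->
    `|velocity_average u z.1.1 z.1.2 - velocity_average v z.1.1 z.1.2| <= K}.
  have : {ae time_plane_measure, forall x : mR3, 0 <= x.1 -> disk x.2 ->
      `|velocity_average u x.1 x.2 - velocity_average v x.1 x.2| <= K}.
    apply: ae_imply2 (ae_prod_x uvK) (ae_and (ae_prod_x aeu) (ae_prod_x aev)).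
    move=> [t x] /= uvx [ux vx] t0 xD.
    have sec (P : mP -> Prop) :
        {ae arc_measure, forall w : mR2, phase_domain (t, x, w) -> P (t, x, w)} ->
        {ae arc_measure, forall w : mR2, unit_circle w -> P (t, x, w)}.
      by apply: ae_imply => w Pw w1; exact: Pw.
    have mux := measurable_velocity_section mu_ t0 xD.
    have mvx := measurable_velocity_section mv t0 xD.
    have avgB := averageB mux mvx
      (sec (fun z => `|u z| <= _) ux) (fine_Linfty_norm_ge0 _ _ _)
      (sec (fun z => `|v z| <= _) vx) (fine_Linfty_norm_ge0 _ _ _).
    apply: (@eq_ind_r _ _ (fun r => `|r| <= K) _ _ avgB).
    apply: le_average => //; last exact: (sec (fun z => `|u z - v z| <= K) uvx).
    exact: measurable_funB.
  move=> /ae_phase_of_time_plane; apply: ae_imply => z zK [? ? _]; exact: zK.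
have aeE := ae_flow_ae eps (ae_and (ae_and uE vE) aeavg).
have aey := @ae_entry_point R eps
  (fun p => u (0, p.1, p.2) = v (0, p.1, p.2)) (fun z => u z = v z) e0
  (ae_imply2 (fun p up vp pD => etrans (up pD) (esym (vp pD))) ui vi)
  (ae_imply2 (fun p up vp pD => etrans (up pD) (esym (vp pD))) ub vb).
apply: ae_imply2 (ae_and aeE aey) (ae_and uAC vAC).
move=> z [zE zy] [zu zv] zD.
set t := entry_time eps z.
have t0 : 0 <= t := entry_time_ge0 e0 zD.
have yD : phase_domain (flow eps (- t) z) := phase_domain_entry_point e0 zD.
pose f s := u (flow eps s z) - v (flow eps s z).
have fAC : absolutely_continuous (- t) 0 f.
  have zt : phase_domain (z + (- t) *: transport_direction eps z.2) by rewrite flowE.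
  have z0 : phase_domain (z + 0 *: transport_direction eps z.2) by rewrite flowE flow0.
  have t0' : - t <= 0 by rewrite oppr_le0.
  have := AC_sub (zu zD _ _ t0' zt z0) (zv zD _ _ t0' zt z0).
  by under eq_fun do rewrite !flowE.
have f0 : f (- t) = 0.
  apply/eqP; rewrite subr_eq0; apply/eqP.
  have [[y0]|[_ //]] := zy zD.
  rewrite -[flow _ _ _]/(entry_point eps z).
  by case: (entry_point eps z) y0 => -[a x] w /= ->.
have fE : {ae mu, forall s, - t < s < 0 ->
    exists2 l, is_derive s 1 f l & `|l + f s| <= K}.
  apply: ae_imply zE => s [[uEs vEs] avgs] /andP[ts s0].
  have sD : phase_domain (flow eps s z).
    rewrite -[s]opprK; apply: phase_domain_flow => //.
      by rewrite oppr_ge0 ltW.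
    by rewrite lerNl ltW.
  have [du Du] := uEs sD; have [dv Dv] := vEs sD.
  exists ('D_(transport_direction eps z.2) u (flow eps s z) -
          'D_(transport_direction eps z.2) v (flow eps s z)).
    exact: is_deriveB (is_derive_flow du) (is_derive_flow dv).
  have := avgs sD; congr (`|_| <= _); exact: eqlin Du Dv.
have t0' : - t <= 0 by rewrite oppr_le0.
have := AC_duhamel t0' fAC f0 fE.
rewrite /f flow0 subr0 => /le_trans; apply.
rewrite mulrC ler_wpM2r// lerD2l lerN2 ler_expR lerN2.
exact: entry_time_le.
Qed.

Lemma transport_solution_unique eps g h u v : 0 < eps ->
  transport_solution eps g h u -> transport_solution eps g h v ->
  u = v %[ae phase_measure in phase_domain].
Proof.
move=> e0 su sv; have [[_ uoo] _ _ _ _] := su; have [[_ voo] _ _ _ _] := sv.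
pose K := fine (Linfty_norm phase_measure phase_domain u) +
          fine (Linfty_norm phase_measure phase_domain v).
have K0 : 0 <= K by rewrite addr_ge0// fine_Linfty_norm_ge0.
pose q : R := 1 - expR (- (2 / eps)).
have q01 : 0 <= q < 1.
  rewrite /q ltrBlDr ltrDl expR_gt0 andbT subr_ge0 -expR0 ler_expR oppr_le0.
  by rewrite divr_ge0// ltW.
have : {ae phase_measure, forall z, forall n, phase_domain z ->
    `|u z - v z| <= q ^+ n * K}.
  apply/ae_foralln; elim => [|n IH].
    apply: ae_imply2 (ae_le_Linfty_norm uoo) (ae_le_Linfty_norm voo).
    move=> z uz vz zD; rewrite expr0 mul1r (le_trans (ler_normB _ _))//.
    by rewrite lerD ?uz ?vz.
  rewrite exprS -mulrA; apply: contraction su sv _ IH => //.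
  by rewrite mulr_ge0// exprn_ge0//; case/andP: q01.
apply: ae_imply => z zn zD; apply/eqP; rewrite -subr_eq0 -normr_le0.
have qn : q ^+ n * K @[n --> \oo] --> 0.
  rewrite -[0](mul0r K); apply: cvgM; last exact: cvg_cst.
  by apply: cvg_expr; case/andP: q01 => q0 q1; rewrite ger0_norm.
by rewrite -(cvg_lim _ qn)//; apply: limr_ge; [apply/cvg_ex; exists 0|near=> n; exact: zn].
Unshelve. all: by end_near. Qed.

End uniqueness.

(** * Solutions along one characteristic *)

Section line_solution.
Context {R : realType}.
Local Notation mu := (@lebesgue_measure R).
Implicit Types (p : R -> R) (a b c t s K M : R).

Lemma Rintegral_expR t : 0 <= t ->
  \int[mu]_(r in `[0, t]) expR r = expR t - 1.
Proof.
rewrite le_eqVlt => /orP[/eqP<-|t0].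
  by rewrite set_itv1 Rintegral_set1 expR0 subrr.
rewrite /Rintegral (@continuous_FTC2 R expR expR)//=.
- by rewrite expR0.
- exact/continuous_subspaceT/continuous_expR.
- split.
  + by move=> x _; exact: derivable_expR.
  + exact/cvg_at_right_filter/continuous_expR.
  + exact/cvg_at_left_filter/continuous_expR.
- by move=> x _; rewrite derive1E; exact: derive_val.
Qed.

Variables (p : R -> R) (M : R).
Hypothesis mp : measurable_fun setT p.
Hypothesis pM : forall r, `|p r| <= M.

Let M0 : 0 <= M. Proof. by apply: le_trans (pM 0). Qed.

Let mep : measurable_fun setT (fun r => expR r * p r).
Proof. by apply: measurable_funM => //; exact: measurable_expR. Qed.

Let integrable_ep (A : set R) b : measurable A -> (mu A < +oo)%E ->
  (forall r, A r -> r <= b) -> mu.-integrable A (EFin \o (fun r => expR r * p r)).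
Proof.
move=> mA Aoo Ab; apply: measurable_bounded_integrable => //.
  exact: measurable_funS mep.
exists (expR b * M); split; first exact: num_real.
move=> x bMx r /= /Ab rb; rewrite (le_trans _ (ltW bMx))// normrM ler_pM//.
by rewrite ger0_norm ?expR_ge0// ler_expR.
Qed.

Let integrable_itv (x y : itv_bound R) b : (x = BLeft 0 \/ exists a, x = BRight a) ->
  y = BRight b -> mu.-integrable [set` Interval x y] (EFin \o (fun r => expR r * p r)).
Proof.
move=> x0 ->; apply: (@integrable_ep _ b); first exact: measurable_itv.
  rewrite lebesgue_measure_itv/=; case: ifPn => // _.
  by case: x0 => [->|[a ->]]; rewrite -EFinB ltry.
by move=> r /=; rewrite in_itv/=; case: x0 => [->|[a ->]] /andP[].
Qed.

Definition line_source t : R := \int[mu]_(r in `[0, t]) (expR r * p r).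

Lemma integrable_line_integrand t :
  mu.-integrable `[0, t] (EFin \o (fun r => expR r * p r)).
Proof. by apply: (@integrable_itv _ _ t); [left|]. Qed.

Lemma line_source0 : line_source 0 = 0.
Proof. by rewrite /line_source set_itv1 Rintegral_set1. Qed.

Lemma line_source_lipschitz b s t : 0 <= s -> s <= t -> t <= b ->
  `|line_source t - line_source s| <= expR b * M * (t - s).
Proof.
move=> s0 st tb; rewrite /line_source Rintegral_itvB; first last.
- by rewrite bnd_simp.
- by rewrite bnd_simp.
- exact: integrable_line_integrand.
have ist : mu.-integrable `]s, t] (EFin \o (fun r => expR r * p r)).
  by apply: (@integrable_itv _ _ t); [right; exists s|].
rewrite (le_trans (le_normr_Rintegral _ ist))//.
rewrite (_ : expR b * M * (t - s) = \int[mu]_(_ in `]s, t]) (expR b * M)); last first.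
  rewrite Rintegral_cst//= lebesgue_measure_itv/= lte_fin.
  case: ltP => [//|ts]; have -> : s = t by apply/le_anti; rewrite st.
  by rewrite subrr.
apply: le_Rintegral => //.
- exact: integrable_norm.
- apply/integrableP; split; first exact: measurable_cst.
  rewrite integral_cst//= lebesgue_measure_itv/= lte_fin.
  by case: ifPn => _; rewrite ?mule0// -EFinB -EFinM ltry.
- move=> r /=; rewrite in_itv/= => /andP[_ rt]; rewrite normrM ler_pM//.
  by rewrite ger0_norm ?expR_ge0// ler_expR (le_trans rt).
Qed.

Lemma line_source_le t : 0 <= t -> `|line_source t| <= M * (expR t - 1).
Proof.
move=> t0; rewrite /line_source.
have it := integrable_line_integrand t.
rewrite (le_trans (le_normr_Rintegral _ it))//.
have ie : mu.-integrable `[0, t] (EFin \o expR).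
  apply: continuous_compact_integrable; first exact: segment_compact.
  exact/continuous_subspaceT/continuous_expR.
rewrite -Rintegral_expR// -RintegralZl//.
apply: le_Rintegral => //.
- exact: integrable_norm.
- by apply: (@eq_integrable _ _ _ mu _ _ (fun r => (M%:E * (EFin \o expR) r)%E));
    [|move=> r _; rewrite /= EFinM|exact: integrableZl].
- by move=> r _; rewrite normrM ger0_norm ?expR_ge0// mulrC ler_wpM2r// expR_ge0.
Qed.

Lemma ae_derive_line_source :
  {ae mu, forall t, 0 < t -> is_derive t 1 line_source (expR t * p t)}.
Proof.
have loc : locally_integrable setT (fun r => expR r * p r).
  split => //; first exact: openT.
  move=> K _ cK; have [N [_ NK]] := compact_bounded cK.
  have mK : measurable K := compact_measurable cK.
  have KN r : K r -> r <= N + 1.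
    by move=> Kr; apply: le_trans (ler_norm _) _; apply: NK => //; rewrite ltrDl.
  have Koo : (mu K < +oo)%E := compact_finite_measure cK.
  by have /integrableP[] := integrable_ep mK Koo KN.
apply: ae_imply (FTC1 integrable_line_integrand loc) => t dt0 t0.
have [|dt tE] := dt0; first by rewrite lte_fin.
by apply: (DeriveDef dt); rewrite -derive1E.
Qed.

(** Duhamel's formula for [f' + f = p] and [f 0 = c]. *)
Definition line_solution c t := expR (- t) * (c + line_source t).

Lemma line_solution_le c t : 0 <= t -> `|c| <= M -> `|line_solution c t| <= M.
Proof.
move=> t0 cM; rewrite /line_solution normrM ger0_norm ?expR_ge0//.
rewrite expRN ler_pdivrMl ?expR_gt0// (le_trans (ler_normD _ _))//.
have := line_source_le t0; lra.
Qed.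

Lemma line_solution_lipschitz c b s t : 0 <= s -> s <= t -> t <= b -> `|c| <= M ->
  `|line_solution c t - line_solution c s| <=
  (expR b * M + (M + M * (expR b - 1))) * (t - s).
Proof.
move=> s0 st tb cM; rewrite /line_solution.
have -> : expR (- t) * (c + line_source t) - expR (- s) * (c + line_source s) =
  expR (- t) * (line_source t - line_source s) +
  (expR (- t) - expR (- s)) * (c + line_source s) by ring.
rewrite (le_trans (ler_normD _ _))// [leRHS]mulrDl !normrM lerD//.
  apply: le_trans (line_source_lipschitz s0 st tb).
  rewrite ler_piMl// ger0_norm ?expR_ge0// -expR0 ler_expR oppr_le0.
  exact: le_trans st.
rewrite mulrC ler_pM//.
  rewrite (le_trans (ler_normD _ _))// lerD//.
  rewrite (le_trans (line_source_le s0))// ler_wpM2l// lerB// ler_expR.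
  exact: le_trans tb.
have ets : `|expR (- s) - expR (- t)| <= 1 * (- s - - t).
  apply: (@derive_bounded_increment R expR expR) => //; first by rewrite lerN2.
  move=> x /andP[_ xs]; rewrite ger0_norm ?expR_ge0// -expR0 ler_expR.
  by rewrite (le_trans xs)// oppr_le0.
by rewrite distrC (le_trans ets)//; lra.
Qed.

Lemma ae_derive_line_solution c : {ae mu, forall t, 0 < t ->
  is_derive t 1 (line_solution c) (p t - line_solution c t)}.
Proof.
apply: ae_imply ae_derive_line_source => t + t0 => /(_ t0) dt.
rewrite /line_solution; apply: is_derive_eq.
rewrite -![_ *: _]/(_ * _) expRN add0r.
by field; rewrite gt_eqF// expR_gt0.
Qed.

End line_solution.

Section line_solution_contraction.
Context {R : realType}.
Implicit Types (p q : R -> R) (c t K M : R).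

Lemma line_solution_contraction p q M K c t :
  measurable_fun setT p -> measurable_fun setT q ->
  (forall r, `|p r| <= M) -> (forall r, `|q r| <= M) ->
  (forall r, `|p r - q r| <= K) -> 0 <= t ->
  `|line_solution p c t - line_solution q c t| <= (1 - expR (- t)) * K.
Proof.
move=> mp mq pM qM pqK t0.
have -> : line_solution p c t - line_solution q c t =
    expR (- t) * (line_source p t - line_source q t).
  by rewrite /line_solution; ring.
have -> : line_source p t - line_source q t = line_source (fun r => p r - q r) t.
  rewrite /line_source -RintegralB//.
  - by apply: eq_Rintegral => r _; rewrite mulrBr.
  - exact: (integrable_line_integrand mp pM t).
  - exact: (integrable_line_integrand mq qM t).
rewrite normrM ger0_norm ?expR_ge0//.
have mpq : measurable_fun setT (fun r => p r - q r) by exact: measurable_funB.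
have := line_source_le mpq pqK t0.
move=> /(ler_wpM2l (expR_ge0 (- t))) /le_trans; apply.
rewrite mulrCA mulrBr mulr1 -expRD addNr expR0 mulrC//.
Qed.

Lemma AC_lipschitz (a b L : R) (f : R -> R) :
  (forall s t, a <= s -> s <= t -> t <= b -> `|f t - f s| <= L * (t - s)) ->
  absolutely_continuous a b f.
Proof.
move=> fL e e0; pose L' := `|L| + 1.
have L'0 : 0 < L' by rewrite ltr_wpDl.
exists (e / L') => [|n I Iab _]; first by rewrite divr_gt0.
rewrite ltr_pdivlMr// mulrC mulr_sumr; apply: le_lt_trans.
apply: ler_sum => i _; have [a1 i12 b2] := Iab i.
apply: le_trans (fL _ _ a1 i12 b2) _; rewrite ler_wpM2r ?subr_ge0//.
by rewrite /L'; have := ler_norm L; lra.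
Qed.

End line_solution_contraction.

(** * Measurability of derivatives and of parametric integrals *)

Section rational_quotients.
Context {R : realType}.
Implicit Types (F : R -> R) (c r s : R).

(** Differentiability at 0 tested on rational increments only: a countable
condition, hence measurable in parameters. *)
Definition rat_derivative F c := forall k : nat, exists n : nat, forall q : rat,
  0 < `|ratr q : R| -> `|ratr q : R| < n.+1%:R^-1 ->
  `|(F (ratr q) - F 0) / ratr q - c| <= k.+1%:R^-1.

Lemma is_derive_quotient F c : is_derive (0 : R) 1 F c <->
  h^-1 * (F h - F 0) @[h --> 0^'] --> c.
Proof.
have E : (fun h : R => h^-1 * (F h - F 0)) =
    (fun h : R => h^-1 *: ((F \o shift 0) (h *: (1 : R)) - F 0)).
  by apply/funext => h; rewrite /= addr0 scaler1.
rewrite E; split.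
  by move=> [dF <-]; exact: dF.
move=> Fc; apply: DeriveDef; first by apply/cvg_ex; exists c.
exact: cvg_lim Fc.
Qed.

Lemma is_derive_recenter (f : R -> R) (a l : R) : is_derive a 1 f l ->
  is_derive (0 : R) 1 (fun r => f (a + r)) l.
Proof.
have E : (fun h : R => h^-1 *: ((f \o shift a) (h *: (1 : R)) - f a)) =
    (fun h : R => h^-1 *: (((fun r => f (a + r)) \o shift 0) (h *: (1 : R))
      - f (a + 0))).
  by apply/funext => h /=; rewrite !addr0 [a + _]addrC.
move=> [df fl]; apply: DeriveDef; first by rewrite /derivable -E.
by rewrite /derive -E.
Qed.

Lemma is_derive_rat F c : is_derive (0 : R) 1 F c -> rat_derivative F c.
Proof.
move=> /is_derive_quotient/cvgrPdist_le Fc k.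
have /Fc[d /= d0 dF] : 0 < k.+1%:R^-1 :> R by rewrite invr_gt0.
have [n nd] : exists n, n.+1%:R^-1 < d.
  exists (Num.truncn d^-1); rewrite invf_plt ?posrE//.
  exact: truncnS_gt.
exists n => q q0 qn; have := dF (ratr q).
rewrite /ball_/= sub0r normrN => /(_ (lt_trans qn nd)).
by rewrite -normr_gt0 => /(_ q0); rewrite distrC mulrC.
Qed.

(** A real increment with a bad quotient would, by continuity, have a rational
neighbour with a bad quotient. *)
Lemma rat_is_derive F c r : 0 < r ->
  (forall s, `|s| < r -> {for s, continuous F}) ->
  rat_derivative F c -> is_derive (0 : R) 1 F c.
Proof.
move=> r0 Fcont Fc; apply/is_derive_quotient/cvgrPdist_le => e e0.
have [k ke] : exists k, k.+1%:R^-1 < e.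
  exists (Num.truncn e^-1); rewrite invf_plt ?posrE//.
  exact: truncnS_gt.
have [n nF] := Fc k.
exists (Num.min r n.+1%:R^-1) => /=; first by rewrite lt_min r0 invr_gt0 ltr0n.
move=> h; rewrite /ball_/= sub0r normrN lt_min => /andP[hr hn] h0.
apply: le_trans (ltW ke).
rewrite leNgt; apply/negP => hk.
have Qcont : {for h, continuous (fun s => `|c - s^-1 * (F s - F 0)|)}.
  apply: cvg_norm; apply: cvgB; first exact: cvg_cst.
  apply: cvgM; first by apply: cvgV => //; exact: cvg_id.
  by apply: cvgB; [exact: Fcont|exact: cvg_cst].
have nk : \forall s \near h, k.+1%:R^-1 < `|c - s^-1 * (F s - F 0)|.
  by apply: (cvgr_gt _ Qcont); exact: hk.
have nn : \forall s \near h, `|s| < n.+1%:R^-1.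
  have nc : {for h, continuous (fun s : R => `|s|)} by exact: norm_continuous.
  by apply: (cvgr_lt _ nc); exact: hn.
have n0 : \forall s \near h, 0 < `|s|.
  have nc : {for h, continuous (fun s : R => `|s|)} by exact: norm_continuous.
  by apply: (cvgr_gt _ nc); rewrite normr_gt0.
have /nbhs_ballP[d /= d0 dh] : \forall s \near h,
    k.+1%:R^-1 < `|c - s^-1 * (F s - F 0)| /\ `|s| < n.+1%:R^-1 /\ 0 < `|s|.
  by apply: filterI => //; exact: filterI.
have [q] : exists q : rat, ratr q \in `]h - d, h + d[.
  by apply: rat_in_itvoo; lra.
rewrite in_itv/= -ltr_distlC => qd.
have [qk [qn q0]] := dh _ qd.
have := nF q q0 qn; rewrite leNgt distrC mulrC.
by move/negP; apply.
Qed.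

End rational_quotients.

(** Tonelli's theorem for the positive and the negative part. *)
Lemma measurable_param_Rintegral d1 d2 (T1 : measurableType d1)
    (T2 : measurableType d2) (R : realType)
    (m : {sigma_finite_measure set T2 -> \bar R}) (f : T1 * T2 -> R) :
  measurable_fun setT f ->
  measurable_fun setT (fun x => Rintegral m setT (fun y => f (x, y))).
Proof.
move=> mf; have /measurable_EFinP mEf := mf.
apply: (measurableT_comp (@fine_measurable _ _ measurableT)).
under eq_fun do rewrite integralE.
apply: emeasurable_funB.
- rewrite (_ : (fun x => _) = fubini_F m (EFin \o f)^\+%E).
    by apply: measurable_fun_fubini_tonelli_F => //; exact: measurable_funepos.
  by apply/funext => x; apply: eq_integral => y _; rewrite !funeposE.
- rewrite (_ : (fun x => _) = fubini_F m (EFin \o f)^\-%E).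
    by apply: measurable_fun_fubini_tonelli_F => //; exact: measurable_funeneg.
  by apply/funext => x; apply: eq_integral => y _; rewrite !funenegE.
Qed.

Section measurable_bad_set.
Context {R : realType}.
Local Notation mR := (measurableTypeR R).
Local Notation mR2 := (mR * mR)%type.
Local Notation mP := (mR * mR2 * mR2)%type.

Lemma measurable_rat_derivative eps (u c : mP -> R) :
  measurable_fun setT u -> measurable_fun setT c ->
  measurable [set z : mP | rat_derivative (fun s => u (flow eps s z)) (c z)].
Proof.
move=> mu_ mc.
pose B k n (q : rat) : set mP := [set z |
  0 < `|ratr q : R| -> `|ratr q : R| < n.+1%:R^-1 ->
  `|(u (flow eps (ratr q) z) - u (flow eps 0 z)) / ratr q - c z| <= k.+1%:R^-1].
have -> : [set z : mP | rat_derivative (fun s => u (flow eps s z)) (c z)] =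
    \bigcap_k \bigcup_n \bigcap_q B k n q.
  apply/seteqP; split => z /=.
    by move=> zd k _; have [n nP] := zd k; exists n => // q _; exact: nP.
  by move=> zd k; have [n _ nP] := zd k I; exists n => q; exact: (nP q I).
apply: bigcapT_measurable => k; apply: bigcupT_measurable => n.
rewrite -[X in measurable X]setCK setC_bigcap.
apply/measurableC/bigcupT_measurable_rat => q; apply: measurableC; rewrite /B.
have [q0|q0] := boolP (0 < `|ratr q : R|); last first.
  by rewrite (_ : [set _ | _] = setT)//; apply/seteqP; split => // z _ /=.
have [qn|qn] := boolP (`|ratr q : R| < n.+1%:R^-1); last first.
  by rewrite (_ : [set _ | _] = setT)//; apply/seteqP; split => // z _ /=.
have mq : measurable_fun [set: mP]
    (fun z : mP => `|(u (flow eps (ratr q) z) - u (flow eps 0 z)) / ratr q - c z|).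
  apply: (measurableT_comp (@normr_measurable _ setT)).
  apply: measurable_funB => //; apply: measurable_funM; last exact: measurable_cst.
  by apply: measurable_funB; apply: (measurableT_comp mu_); exact: measurable_flow.
have := mq measurableT _ (measurable_itv `]-oo, k.+1%:R^-1]).
rewrite setTI; congr measurable; apply/seteqP; split => z /=; rewrite in_itv/=.
  by [].
by apply.
Qed.

End measurable_bad_set.

(** * The mild solution with a given source *)

Section mild.
Context {R : realType}.
Local Notation mR := (measurableTypeR R).
Local Notation mR2 := (mR * mR)%type.
Local Notation mR3 := (mR * mR2)%type.
Local Notation mP := (mR * mR2 * mR2)%type.
Local Notation mu := (@lebesgue_measure R).

Definition entry_data (h : mR2 * mR2 -> R) (g : mP -> R) (y : mP) : R :=
  if (y.1.1 : R) == 0 then h (y.1.2, y.2) else g y.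

(** Duhamel's formula: the value at [z] of the solution with source [m] on the
characteristic that carries the datum from the entry point of [z]. *)
Definition mild_solution (eps : R) (h : mR2 * mR2 -> R) (g : mP -> R) (m : mR3 -> R)
    (z : mP) : R :=
  line_solution (fun r => m (flow eps r (entry_point eps z)).1)
    (entry_data h g (entry_point eps z)) (entry_time eps z).

Variables (eps M : R) (h : mR2 * mR2 -> R) (g : mP -> R).
Hypothesis eps0 : 0 < eps.
Hypothesis mh : measurable_fun setT h.
Hypothesis mg : measurable_fun setT g.
Hypothesis hM : forall p, `|h p| <= M.
Hypothesis gM : forall z, `|g z| <= M.
Local Notation mild := (mild_solution eps h g).

Let M0 : 0 <= M. Proof. by apply: le_trans (hM 0). Qed.

Lemma entry_data_le y : `|entry_data h g y| <= M.
Proof. by rewrite /entry_data; case: ifP. Qed.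

Lemma measurable_entry_data : measurable_fun setT (entry_data h g).
Proof.
apply: measurable_fun_ifT => //.
  by apply: measurable_fun_eqr; [measurability|exact: measurable_cst].
by apply: (measurableT_comp mh (g := fun y : mP => (y.1.2, y.2))); measurability.
Qed.

Lemma measurable_source_line (m : mR3 -> R) (y : mP) : measurable_fun setT m ->
  measurable_fun [set: R] (fun r : R => m (flow eps r y).1).
Proof.
move=> mm; apply: (measurableT_comp mm (g := fun r : mR => (flow eps r y).1)).
apply: (measurableT_comp measurable_fst).
by apply: (measurableT_comp (measurable_flow2 eps) (g := fun r : mR => (r, y)));
  measurability.
Qed.

Lemma measurable_mild (m : mR3 -> R) : measurable_fun setT m ->
  measurable_fun setT (mild m).
Proof.
move=> mm.
have mt := @measurable_entry_time R eps.
have my := @measurable_entry_point R eps.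
apply: measurable_funM.
  apply: (measurableT_comp (@measurable_expR R)).
  exact: (measurableT_comp (@oppr_measurable _ setT)).
apply: measurable_funD.
  exact: (measurableT_comp measurable_entry_data).
pose F (p : mP * mR) : R := if (0 <= (p.2 : R)) && ((p.2 : R) <= entry_time eps p.1)
  then expR p.2 * m (flow eps p.2 (entry_point eps p.1)).1 else 0.
have mF : measurable_fun [set: mP * mR] F.
  apply: measurable_fun_ifT; last exact: measurable_cst.
    apply: measurable_and; apply: measurable_fun_ler; try by measurability.
    by apply: (measurableT_comp mt); measurability.
  apply: measurable_funM.
    by apply: (measurableT_comp (@measurable_expR R)); measurability.
  apply: (measurableT_comp mm).
  apply: (measurableT_comp measurable_fst).
  apply: (measurableT_comp (measurable_flow2 eps)
    (g := fun p : mP * mR => (p.2, entry_point eps p.1))).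
  apply: measurable_fun_pair; first by measurability.
  by apply: (measurableT_comp my); measurability.
have := @measurable_param_Rintegral _ _ mP mR R mu F mF.
congr (measurable_fun _ _); apply/funext => z.
rewrite /line_source [RHS]Rintegral_mkcond; apply: eq_Rintegral => r _.
by rewrite /F/= patchE mem_setE in_itv/=.
Qed.

Lemma mild_le (m : mR3 -> R) z : measurable_fun setT m -> (forall x, `|m x| <= M) ->
  phase_domain z -> `|mild m z| <= M.
Proof.
move=> mm mM zD; apply: line_solution_le.
- exact: measurable_source_line.
- by move=> r; exact: mM.
- exact: entry_time_ge0.
- exact: entry_data_le.
Qed.

Lemma mild_contraction (m m' : mR3 -> R) K z : measurable_fun setT m ->
  measurable_fun setT m' -> (forall x, `|m x| <= M) -> (forall x, `|m' x| <= M) ->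
  (forall x, `|m x - m' x| <= K) -> phase_domain z ->
  `|mild m z - mild m' z| <= (1 - expR (- (2 / eps))) * K.
Proof.
move=> mm mm' mM mM' mK zD.
have K0 : 0 <= K by apply: le_trans (mK 0).
have t0 := entry_time_ge0 eps0 zD.
have := line_solution_contraction (entry_data h g (entry_point eps z))
  (measurable_source_line (entry_point eps z) mm)
  (measurable_source_line (entry_point eps z) mm')
  (fun r => mM _) (fun r => mM' _) (fun r => mK _) t0.
move=> /le_trans; apply; rewrite ler_wpM2r// lerD2l lerN2 ler_expR lerN2.
exact: entry_time_le.
Qed.

Lemma mild_flow (m : mR3 -> R) z s : unit_circle z.2 ->
  mild m (flow eps s z) =
  line_solution (fun r => m (flow eps r (entry_point eps z)).1)
    (entry_data h g (entry_point eps z)) (entry_time eps z + s).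
Proof. by move=> z2; rewrite /mild_solution entry_point_flow// entry_time_flow. Qed.

Lemma mild_entry (m : mR3 -> R) z : entry_time eps z = 0 -> mild m z = entry_data h g z.
Proof.
move=> t0; rewrite /mild_solution /line_solution t0 line_source0 oppr0 expR0 mul1r addr0.
by rewrite /entry_point t0 oppr0 flow0.
Qed.

Lemma mild_flow_lipschitz (m : mR3 -> R) z b : measurable_fun setT m ->
  (forall x, `|m x| <= M) -> unit_circle z.2 ->
  exists L, forall s t, 0 <= entry_time eps z + s -> s <= t -> t <= b ->
    `|mild m (flow eps t z) - mild m (flow eps s z)| <= L * (t - s).
Proof.
move=> mm mM z2; set c := entry_time eps z.
exists (expR (c + b) * M + (M + M * (expR (c + b) - 1))) => s t s0 st tb.
rewrite !mild_flow// -/c.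
have -> : t - s = (c + t) - (c + s) by ring.
apply: line_solution_lipschitz => //.
- exact: measurable_source_line.
- by rewrite lerD2l.
- by rewrite lerD2l.
- exact: entry_data_le.
Qed.

Lemma mild_AC (m : mR3 -> R) z a b : measurable_fun setT m ->
  (forall x, `|m x| <= M) -> phase_domain z ->
  phase_domain (z + a *: transport_direction eps z.2) ->
  absolutely_continuous a b (fun s => mild m (z + s *: transport_direction eps z.2)).
Proof.
move=> mm mM [_ _ z2]; rewrite flowE => aD.
have [L mL] := mild_flow_lipschitz b mm mM z2.
apply: (@AC_lipschitz _ _ _ L) => s t as_ st tb; rewrite !flowE.
apply: mL => //; rewrite (le_trans (entry_time_ge0 eps0 aD))//.
by rewrite entry_time_flow// lerD2l.
Qed.

(** By the Lebesgue differentiation theorem on each characteristic, and Fubini.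
Rational increments make the set of good points measurable; continuity of the
mild solution along the characteristic gives the other increments. *)
Lemma ae_derive_mild (m : mR3 -> R) : measurable_fun setT m ->
  (forall x, `|m x| <= M) ->
  {ae phase_measure, forall z : mP, phase_domain z ->
    derivable (mild m) z (transport_direction eps z.2) /\
    'D_(transport_direction eps z.2) (mild m) z = m z.1 - mild m z}.
Proof.
move=> mm mM; have mmild := measurable_mild mm.
pose G : set mP := [set z | rat_derivative (fun s => mild m (flow eps s z))
  (m z.1 - mild m z)].
have mG : measurable G.
  apply: measurable_rat_derivative => //; apply: measurable_funB => //.
  by apply: (measurableT_comp mm); measurability.
(* Entry points are excluded: the integral of the source starts there. *)
pose B : set mP := @phase_domain R `&` ([set z | entry_time eps z <= 0] `|` ~` G).
have mB : measurable B.
  apply: measurableI; first exact: measurable_phase_domain.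
  apply: measurableU; last exact: measurableC.
  have := @measurable_entry_time R eps measurableT _ (measurable_itv `]-oo, 0]).
  by rewrite setTI; congr measurable; apply/seteqP; split => z /=; rewrite in_itv.
suff : {ae phase_measure, forall z, ~ B z}.
  apply: ae_imply => z zB zD.
  have t0 : 0 < entry_time eps z.
    by rewrite ltNge; apply/negP => t0; apply: zB; split => //; left.
  have zG : G z by apply: contrapT => zG; apply: zB; split => //; right.
  apply: derive_of_flow; apply: (rat_is_derive t0) zG => s st.
  have z2 : unit_circle z.2 by case: zD.
  have [L mL] := mild_flow_lipschitz (entry_time eps z) mm mM z2.
  have nc : {for s, continuous (fun s : R => `|s|)} by exact: norm_continuous.
  apply/cvgrPdist_le => e e0 /=.
  near=> r.
  have L'0 : 0 < `|L| + 1 by rewrite ltr_wpDl.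
  have rs : `|r - s| <= e / (`|L| + 1).
    by near: r; apply: cvgr_distC_le => //; rewrite divr_gt0.
  have rt : `|r| < entry_time eps z.
    by near: r; apply: (cvgr_lt _ nc); exact: st.
  have key x y : `|x| < entry_time eps z -> `|y| < entry_time eps z -> x <= y ->
      `|y - x| <= e / (`|L| + 1) ->
      `|mild m (flow eps y z) - mild m (flow eps x z)| <= e.
    rewrite !ltr_norml => /andP[xt _] /andP[_ yt] xy yx.
    apply: le_trans (mL x y _ xy (ltW yt)) _; first by lra.
    move: yx; rewrite ger0_norm ?subr_ge0// ler_pdivlMr// => yx.
    have : L * (y - x) <= (`|L| + 1) * (y - x).
      by rewrite ler_wpM2r ?subr_ge0//; have := ler_norm L; lra.
    lra.
  have [sr|/ltW rs'] := leP s r; last by apply: key => //; rewrite distrC.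
  by rewrite distrC; apply: key.
apply: (@ae_of_ae_flow _ eps) => // z.
have [z2|z2] := pselect (unit_circle z.2); last first.
  by apply: aeW => s [[_ _ /=]].
pose y := entry_point eps z; pose c := entry_time eps z.
pose p r := m (flow eps r y).1.
have pM r : `|p r| <= M by exact: mM.
have mp : measurable_fun setT p by exact: measurable_source_line.
have := ae_translate c (ae_derive_line_solution mp pM (entry_data h g y)).
move=> /ae_and/(_ (ae_neq2 (- c) 0)).
apply: ae_imply => s [dl [sc _]] [sD Bs].
have st : entry_time eps (flow eps s z) = s + c by rewrite entry_time_flow// addrC.
have sc0 : 0 < s + c.
  rewrite lt_neqAle -st entry_time_ge0// andbT st; apply/eqP => sc0.
  by apply: sc; lra.
case: Bs => [|]; first by rewrite /= st leNgt sc0.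
apply; have := is_derive_recenter (dl sc0) => dl0.
have dlE : (fun r => line_solution p (entry_data h g y) (s + c + r)) =
    (fun r => mild m (flow eps r (flow eps s z))).
  by apply/funext => r; rewrite flowD mild_flow// -/c -/y addrA [s + c]addrC.
rewrite dlE in dl0.
apply: is_derive_rat; move: dl0; congr (is_derive _ _ _ _).
have fE : flow eps (s + c) y = flow eps s z.
  by rewrite -st /y -(entry_point_flow s eps0 z2) flow_entry.
by rewrite mild_flow// -/c -/y [c + s]addrC -fE.
Unshelve. all: by end_near. Qed.

End mild.

(** * The fixed point *)

Section fixed_point.
Context {R : realType}.
Local Notation mR := (measurableTypeR R).
Local Notation mR2 := (mR * mR)%type.
Local Notation mR3 := (mR * mR2)%type.
Local Notation mP := (mR * mR2 * mR2)%type.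
Local Notation mu := (@lebesgue_measure R).

Definition base_domain : set (R * (R * R)) := [set x | 0 <= x.1 /\ disk x.2].

Definition averaged (u : mP -> R) : mR3 -> R :=
  (fun x : mR3 => velocity_average u x.1 x.2) \_ base_domain.

Lemma averagedE (u : mP -> R) (t : R) (x : R * R) : 0 <= t -> disk x ->
  averaged u (t, x) = average (fun w : mR2 => u (t, x, w)).
Proof. by move=> t0 xD; rewrite /averaged patchE mem_set. Qed.

Lemma averaged_out (u : mP -> R) x : ~ base_domain x -> averaged u x = 0.
Proof. by move=> xD; rewrite /averaged patchE memNset. Qed.

Lemma measurable_base_domain : measurable (base_domain : set mR3).
Proof.
have -> : base_domain = [set t | 0 <= t] `*` @disk R by [].
apply: measurableX; last exact: measurable_disk.
by rewrite -set_itv_c_infty; exact: measurable_itv.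
Qed.

Lemma measurable_averaged (u : mP -> R) :
  measurable_fun setT u -> measurable_fun setT (averaged u).
Proof.
move=> mu_; apply/(measurable_restrictT _ measurable_base_domain).
apply: (@measurable_funS _ _ _ _ setT) => //.
apply: measurable_funM; first exact: measurable_cst.
have mC : measurable ((snd : mR3 * mR2 -> mR2) @^-1` @unit_circle R).
  rewrite -[X in measurable X]setTI.
  by apply: measurable_snd => //; exact: measurable_unit_circle.
have mF := (measurable_restrictT _ mC).1 (measurable_funS measurableT (@subsetT _ _)
  (mu_ : measurable_fun [set: mR3 * mR2] u)).
have := measurable_param_Rintegral arc_measure mF.
congr (measurable_fun _ _); apply/funext => -[t x].
rewrite [RHS]Rintegral_mkcond; apply: eq_Rintegral => w _.
by rewrite !patchE.
Qed.

Lemma average_le_on (u : mP -> R) (K t : R) (x : R * R) :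
  measurable_fun setT u -> 0 <= t -> disk x -> 0 <= K ->
  (forall z, phase_domain z -> `|u z| <= K) ->
  measurable_fun unit_circle (fun w : mR2 => u (t, x, w)) /\
  {ae arc_measure, forall w, unit_circle w -> `|u (t, x, w)| <= K}.
Proof.
move=> mu_ t0 xD K0 uK; split.
  by apply: measurable_velocity_section => //; exact: measurable_funS mu_.
by apply: aeW => w w1; apply: uK.
Qed.

Lemma averaged_le (u : mP -> R) (K : R) x : measurable_fun setT u -> 0 <= K ->
  (forall z, phase_domain z -> `|u z| <= K) -> `|averaged u x| <= K.
Proof.
move=> mu_ K0 uK; have [xD|xD] := pselect (base_domain x); last first.
  by rewrite averaged_out// normr0.
case: x xD => t x [t0 xD]; rewrite averagedE//.
by have [? ?] := average_le_on mu_ t0 xD K0 uK; apply: le_average.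
Qed.

Lemma averaged_contraction (u v : mP -> R) (M K : R) x :
  measurable_fun setT u -> measurable_fun setT v ->
  0 <= M -> 0 <= K ->
  (forall z, phase_domain z -> `|u z| <= M) ->
  (forall z, phase_domain z -> `|v z| <= M) ->
  (forall z, phase_domain z -> `|u z - v z| <= K) ->
  `|averaged u x - averaged v x| <= K.
Proof.
move=> mu_ mv M0 K0 uM vM uvK; have [xD|xD] := pselect (base_domain x); last first.
  by rewrite !averaged_out// subr0 normr0.
case: x xD => t x [t0 xD]; rewrite !averagedE//.
have [mus aeu] := average_le_on mu_ t0 xD M0 uM.
have [mvs aev] := average_le_on mv t0 xD M0 vM.
have muv : measurable_fun setT (fun z => u z - v z) by exact: measurable_funB.
have [muvs aeuv] := average_le_on muv t0 xD K0 uvK.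
rewrite (averageB mus mvs aeu M0 aev M0).
exact: le_average.
Qed.

Variables (eps M : R) (h : mR2 * mR2 -> R) (g : mP -> R).
Hypothesis eps0 : 0 < eps.
Hypothesis mh : measurable_fun setT h.
Hypothesis mg : measurable_fun setT g.
Hypothesis hM : forall p, `|h p| <= M.
Hypothesis gM : forall z, `|g z| <= M.
Local Notation mild := (mild_solution eps h g).
Local Notation q := (1 - expR (- (2 / eps))).

Let M0 : 0 <= M. Proof. by apply: le_trans (hM 0). Qed.

Lemma contraction_factor : 0 <= q < 1.
Proof.
rewrite ltrBlDr ltrDl expR_gt0 andbT subr_ge0 -expR0 ler_expR oppr_le0.
by rewrite divr_ge0// ltW.
Qed.

Let admissible (m : mR3 -> R) := measurable_fun setT m /\ forall x, `|m x| <= M.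

Let step_admissible m : admissible m -> admissible (averaged (mild m)).
Proof.
move=> [mm mM]; have mmild := measurable_mild eps mh mg mm.
split; first exact: measurable_averaged.
move=> x; apply: averaged_le => // z; exact: mild_le.
Qed.

Let step_contraction m m' K : admissible m -> admissible m' ->
  (forall x, `|m x - m' x| <= K) ->
  forall x, `|averaged (mild m) x - averaged (mild m') x| <= q * K.
Proof.
move=> [mm mM] [mm' mM'] mK x.
have K0 : 0 <= K by apply: le_trans (mK 0).
have mmild := measurable_mild eps mh mg mm.
have mmild' := measurable_mild eps mh mg mm'.
have [q0 _] := andP contraction_factor.
apply: (averaged_contraction _ mmild mmild' M0) => //.
- by rewrite mulr_ge0.
- by move=> z; exact: mild_le.
- by move=> z; exact: mild_le.
- by move=> z; exact: (mild_contraction h g eps0 mm mm' mM mM' mK).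
Qed.

(** The Picard iterates from 0 satisfy |m_(k+i) - m_k| <= q^k M, hence converge
uniformly, which keeps measurability and the bound. *)
Lemma exists_mild_fixed_point : exists m : mR3 -> R,
  [/\ measurable_fun setT m, (forall x, `|m x| <= M) & averaged (mild m) = m].
Proof.
pose m_ k := iter k (fun m => averaged (mild m)) (cst 0).
have m_adm k : admissible (m_ k).
  elim: k => [|k IH]; last exact: step_admissible.
  by split => [|x]; [exact: measurable_cst|rewrite normr0].
have m_cauchy k i x : `|m_ (k + i)%N x - m_ k x| <= q ^+ k * M.
  elim: k x => [|k IH] x.
    by rewrite expr0 mul1r add0n [m_ 0]/m_/= subr0; exact: (m_adm i).2.
  by rewrite exprS -mulrA addSn; exact: (step_contraction (m_adm _) (m_adm _) IH).
have qM : q ^+ k * M @[k --> \oo] --> 0.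
  rewrite -[0](mul0r M); apply: cvgM; last exact: cvg_cst.
  by apply: cvg_expr; case/andP: contraction_factor => q0 q1; rewrite ger0_norm.
have m_cvg x : cvg (m_ k x @[k --> \oo]).
  apply: cauchy_cvg; apply: cauchy_exP => e e0.
  have /cvgrPdist_lt/(_ e e0)[k _ kP] := qM.
  exists (m_ k x); exists k => // n /= kn.
  have := kP k (leqnn k); rewrite /= sub0r normrN => /(le_lt_trans (ler_norm _)).
  rewrite /ball/= distrC => /(le_lt_trans _); apply.
  by have := m_cauchy k (n - k)%N x; rewrite subnKC.
pose m x : R := limn (fun k => m_ k x).
have m_lim x : m_ k x @[k --> \oo] --> m x by exact: m_cvg.
have mM x : `|m x| <= M.
  have ml : `|m_ k x| @[k --> \oo] --> `|m x| by apply: cvg_norm; exact: m_lim.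
  rewrite -(cvg_lim _ ml)//; apply: limr_le; first by apply/cvg_ex; exists `|m x|.
  by near=> k; exact: (m_adm k).2.
have m_err k x : `|m x - m_ k x| <= q ^+ k * M.
  have ml : `|m_ (i + k)%N x - m_ k x| @[i --> \oo] --> `|m x - m_ k x|.
    apply: cvg_norm; apply: cvgB; last exact: cvg_cst.
    by have := m_lim x; rewrite -(cvg_shiftn k).
  rewrite -(cvg_lim _ ml)//; apply: limr_le.
    by apply/cvg_ex; exists `|m x - m_ k x|.
  by near=> i; rewrite addnC.
have m_meas : measurable_fun setT m.
  apply: (@measurable_fun_cvg _ _ _ _ m_) => [k|x _]; last exact: m_lim.
  by have [] := m_adm k.
have adm : admissible m by [].
exists m; split => //; apply/funext => x.
have m1 : m_ k.+1 x @[k --> \oo] --> m x.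
  by have := m_lim x; rewrite -(cvg_shiftS (fun k => m_ k x)).
have m2 : m_ k.+1 x @[k --> \oo] --> averaged (mild m) x.
  apply/cvgrPdist_le => e e0; have /cvgrPdist_lt/(_ e e0) := qM.
  apply: filterS => k; rewrite sub0r normrN => /ltW ke.
  have [q0 q1] := andP contraction_factor.
  have := step_contraction adm (m_adm k) (m_err k) x.
  move=> /le_trans; apply; apply: le_trans (le_trans (ler_norm _) ke).
  by rewrite ler_piMl ?(ltW q1)// mulr_ge0// exprn_ge0.
exact: (cvg_unique _ m2 m1).
Unshelve. all: by end_near. Qed.

End fixed_point.

(** * Existence *)

Section existence.
Context {R : realType}.
Local Notation mR := (measurableTypeR R).
Local Notation mR2 := (mR * mR)%type.
Local Notation mR3 := (mR * mR2)%type.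
Local Notation mP := (mR * mR2 * mR2)%type.

(** Truncating the data at an essential bound changes them on null sets only and
makes the bound hold everywhere. *)
Definition clip (M r : R) : R := Num.max (- M) (Num.min M r).

Lemma clip_le M r : 0 <= M -> `|clip M r| <= M.
Proof.
move=> M0; rewrite /clip ler_norml le_max lexx/= ge_max ge_min lexx/= andbT.
lra.
Qed.

Lemma clip_id M r : `|r| <= M -> clip M r = r.
Proof.
rewrite ler_norml => /andP[lo hi].
by rewrite /clip (min_idPr hi) (max_idPr lo).
Qed.

Lemma measurable_clip d (T : measurableType d) (D : set T) (f : T -> R) M :
  measurable D -> measurable_fun D f ->
  measurable_fun setT (fun x => clip M ((f \_ D) x)).
Proof.
move=> mD /(measurable_restrictT _ mD) mf.
apply: measurable_maxr; first exact: measurable_cst.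
by apply: measurable_minr => //; exact: measurable_cst.
Qed.

(** At time 0 a point of the in-flow boundary is its own entry point and the mild
solution takes the value of [h] there; compatibility makes this the value of [g]. *)
Lemma exists_transport_solution (eps : R) (g : R * (R * R) * (R * R) -> R)
    (h : (R * R) * (R * R) -> R) : 0 < eps ->
  Linfty boundary_measure boundary_domain g ->
  Linfty initial_measure initial_domain h ->
  (forall x0 w : R * R, in_flow (x0, w) -> h (x0, w) = g (0, x0, w)) ->
  exists u, transport_solution eps g h u /\
    (Linfty_norm phase_measure phase_domain u <=
       Linfty_norm initial_measure initial_domain h +
       Linfty_norm boundary_measure boundary_domain g)%E.
Proof.
move=> e0 [mg goo] [mh hoo] compat.
set Nh := fine (Linfty_norm initial_measure initial_domain h).
set Ng := fine (Linfty_norm boundary_measure boundary_domain g).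
have Nh0 : 0 <= Nh by exact: fine_Linfty_norm_ge0.
have Ng0 : 0 <= Ng by exact: fine_Linfty_norm_ge0.
pose M := Nh + Ng; have M0 : 0 <= M by rewrite addr_ge0.
pose hc (p : mR2 * mR2) := clip M ((h \_ initial_domain) p).
pose gc (z : mP) := clip M ((g \_ boundary_domain) z).
have mhc : measurable_fun setT hc.
  by apply: measurable_clip mh; exact: measurable_initial_domain.
have mgc : measurable_fun setT gc.
  by apply: measurable_clip mg; exact: measurable_boundary_domain.
have hcM p : `|hc p| <= M by exact: clip_le.
have gcM z : `|gc z| <= M by exact: clip_le.
have [m [mm mM mE]] := exists_mild_fixed_point e0 mhc mgc hcM gcM.
pose u := mild_solution eps hc gc m.
have mu_ : measurable_fun setT u by exact: measurable_mild.
have uM z : phase_domain z -> `|u z| <= M by exact: mild_le.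
have uN : (Linfty_norm phase_measure phase_domain u <= M%:E)%E.
  by apply: Linfty_norm_le => //; exact: aeW.
have avgE z : phase_domain z -> m z.1 = velocity_average u z.1.1 z.1.2.
  by case: z => -[t x] w [t0 xD _]; rewrite -mE averagedE.
exists u; split; last first.
  by rewrite -(Linfty_norm_fineK hoo) -(Linfty_norm_fineK goo) -EFinD.
split.
- split; first exact: measurable_funS mu_.
  by rewrite (le_lt_trans uN)// ltry.
- by apply: aeW => z zD a b _ aD _; exact: (mild_AC e0 hcM gcM).
- apply: ae_imply (ae_derive_mild e0 mhc mgc hcM gcM mm mM) => z zE zD.
  have [dz ->] := zE zD; split => //; rewrite (avgE z zD) -/u; lra.
- apply: ae_imply (ae_le_Linfty_norm hoo) => p hp pD.
  have zD : phase_domain (0, p.1, p.2) by case: pD.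
  rewrite /u mild_entry; last exact: entry_time_initial.
  rewrite /entry_data eqxx/= -surjective_pairing /hc patchE mem_set//.
  by rewrite clip_id// (le_trans (hp pD))// lerDl.
- apply: ae_imply (ae_le_Linfty_norm goo) => z gz zD.
  rewrite /u mild_entry; last exact: entry_time_in_flow.
  rewrite /entry_data; have [t0|t0] := eqVneq (z.1.1 : R) 0.
    have [_ zin] := zD.
    rewrite /hc patchE mem_set; last first.
      by split; [exact: in_flow_disk zin|case: zin].
    rewrite (compat _ _ zin) -t0 -!surjective_pairing.
    by rewrite clip_id// (le_trans (gz zD))// lerDr.
  by rewrite /gc patchE mem_set// clip_id// (le_trans (gz zD))// lerDr.
Qed.

End existence.

Unset Implicit Arguments.

Theorem theorem1p1 (R : realType) :
  exists C : R, 0 < C /\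
  exists eps0 : R, 0 < eps0 /\
  forall (eps : R) (g : R * (R * R) * (R * R) -> R) (h : (R * R) * (R * R) -> R),
    0 < eps -> eps < eps0 ->
    Linfty boundary_measure boundary_domain g ->
    Linfty initial_measure initial_domain h ->
    (forall x0 w : R * R, in_flow (x0, w) -> h (x0, w) = g (0, x0, w)) ->
    exists u : R * (R * R) * (R * R) -> R,
      [/\ transport_solution eps g h u,
          (Linfty_norm phase_measure phase_domain u <=
             C%:E * (Linfty_norm initial_measure initial_domain h +
                     Linfty_norm boundary_measure boundary_domain g))%E
        & forall v, transport_solution eps g h v ->
            u = v %[ae phase_measure in phase_domain]].
Proof.
exists 1; split => //; exists 1; split => // eps g h e0 _ gL hL compat.
have [u [us uN]] := exists_transport_solution e0 gL hL compat.
exists u; split => //; first by rewrite mul1e.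
by move=> v vs; exact: transport_solution_unique e0 us vs.
Qed.
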